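(* Let $1<p<\infty$, $0<q,r<\infty$ and $0<s<\rho<\infty$ satisfy $$p>q,\qquad \frac1q=\frac1p+\frac1\rho,\qquad \frac1q=\frac1p+\frac1s-\frac1n.$$ Then there is a constant $C>0$, depending only on $n,p,q,r,s,\rho$, such that for every cube $Q\in\mathcal{Q}(\mathbb{R}^n)$ and every $f\in Lip(Q)$ the following hold. (1) If $1<q<r$, then for all $g\in\mathcal{M}^s_{r,\rho}(Q)$, $$\|g(f-f_Q)\|_{L^q(Q)}\le C\,\|g\|_{\mathcal{M}^s_{r,\rho}(Q)}\,\|\nabla f\|_{L^p(Q)}.$$ (2) If $q\le1$, then for all $g\in\mathcal{M}^s_{q,\rho}(Q)$, $$\|g(f-f_Q)\|_{L^q(Q)}\le C\,\|g\|_{\mathcal{M}^s_{q,\rho}(Q)}\,\|\nabla f\|_{L^p(Q)}.$$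
   Context: $\mathcal{Q}(\mathbb{R}^n)$ is the collection of all cubes in $\mathbb{R}^n$ with sides parallel to the coordinate axes. $\mathcal{D}(Q)$ is the collection of all cubes obtained from $Q$ by finitely many (possibly zero) bisections, i.e. the dyadic subcubes of $Q$, including $Q$ itself. $f_Q=\frac{1}{|Q|}\int_Q f(x)\,dx$. $Lip(Q)$ is the family of all Lipschitz continuous functions on $Q$. $L^1_{\rm loc}(Q)$ is the space of functions integrable on every compact subset of $Q$. For $0<s,t,\rho<\infty$, the Morrey space $\mathcal{M}^s_{t,\rho}(Q)$ is the family of all $g\in L^1_{\rm loc}(Q)$ with $$\|g\|_{\mathcal{M}^s_{t,\rho}(Q)}:=\left(\sum_{R\in\mathcal{D}(Q)}\left[|R|^{\frac1s-\frac1t}\|g\|_{L^t(R)}\right]^\rho\right)^{\frac1\rho}<\infty.$$ *)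

(* Defs.v *)
From HB Require Import structures.
From mathcomp Require Import all_boot all_order all_algebra.
From mathcomp Require Import all_classical all_reals all_analysis.
Set Implicit Arguments.
Unset Strict Implicit.
Unset Printing Implicit Defensive.
Import Order.TTheory GRing.Theory Num.Theory.
Import numFieldNormedType.Exports.
Local Open Scope classical_set_scope.
Local Open Scope ring_scope.

(* The sigma-algebra on R^n generated by the coordinate projections, which is
   the Borel sigma-algebra.  The library provides it on n.-tuple R only, which
   carries no normed structure. *)

Fact borel_rV_display : measure_display. Proof. exact: default_measure_display. Qed.

Section borel_rV.
Context {R : realType} {n : nat}.

Definition rV_coord (i : 'I_n) (x : 'rV[R]_n) : measurableTypeR R := x 0 i.

Let rV_set0 : g_sigma_preimage rV_coord set0.
Proof. exact: sigma_algebra0. Qed.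

Let rV_setC A : g_sigma_preimage rV_coord A -> g_sigma_preimage rV_coord (~` A).
Proof. exact: sigma_algebraC. Qed.

Let rV_bigcup (F : (set 'rV[R]_n)^nat) :
  (forall i, g_sigma_preimage rV_coord (F i)) ->
  g_sigma_preimage rV_coord (\bigcup_i (F i)).
Proof. exact: sigma_algebra_bigcup. Qed.

HB.instance Definition _ := @isMeasurable.Build borel_rV_display
  'rV[R]_n (g_sigma_preimage rV_coord) rV_set0 rV_setC rV_bigcup.

End borel_rV.

Lemma measurable_rV_coord (R : realType) n (i : 'I_n) :
  measurable_fun [set: 'rV[R]_n] (rV_coord i).
Proof.
move=> _ Y mY; rewrite setTI; apply: sub_sigma_algebra => /=.
rewrite -bigcup_seq/=; exists i => /=; first by rewrite mem_index_enum.
by exists Y => //; rewrite setTI.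
Qed.

Lemma measurable_fun_rV (R : realType) n d (T : measurableType d)
    (f : T -> 'rV[R]_n) :
  (forall i, measurable_fun [set: T] (rV_coord i \o f)) ->
  measurable_fun [set: T] f.
Proof.
move=> mf _ A mA; rewrite setTI.
suff : g_sigma_preimage (@rV_coord R n) `<=` [set B | measurable (f @^-1` B)].
  exact.
apply: smallest_sub.
  split => /= [|B mB|F mF].
  - by rewrite preimage_set0; exact: measurable0.
  - by rewrite setTD preimage_setC; exact: measurableC.
  - by rewrite preimage_bigcup; exact: bigcupT_measurable.
rewrite -bigcup_seq => B [i _ [C mC <-]] /=.
by rewrite setTI -comp_preimage -[X in measurable X]setTI; exact: mf.
Qed.

(* Lebesgue measure on the Borel sets of R^n, as the n-fold product of the
   one-dimensional Lebesgue measure *)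

Section lebesgue_borel.
Context {R : realType}.

Definition rV_cons n (x : measurableTypeR R * 'rV[R]_n) : 'rV[R]_n.+1 :=
  row_mx (x.1 : R)%:M x.2.

Definition rV_uncons n (x : 'rV[R]_n.+1) : measurableTypeR R * 'rV[R]_n :=
  (x 0 0, \row_i x 0 (lift ord0 i)).

Lemma rV_consK n : cancel (@rV_cons n) (@rV_uncons n).
Proof.
move=> [a v]; rewrite /rV_cons /rV_uncons; congr pair => /=.
  rewrite mxE; case: splitP => [j _|k //].
  by rewrite !ord1 mxE.
apply/rowP => i; rewrite !mxE; case: splitP => [j|k].
  by rewrite ord1.
by rewrite /bump/= add1n => -[]/val_inj ->.
Qed.

Lemma measurable_rV_cons n : measurable_fun [set: measurableTypeR R * 'rV[R]_n]
  (@rV_cons n).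
Proof.
apply: measurable_fun_rV => i; case: (unliftP ord0 i) => [j ->|->].
  rewrite (_ : _ \o _ = rV_coord j \o snd).
    exact: measurableT_comp (@measurable_rV_coord _ _ j) measurable_snd.
  apply/funext => x; have /rowP/(_ j) := congr1 snd (rV_consK x).
  by rewrite mxE.
rewrite (_ : _ \o _ = fst)//; apply/funext => x.
exact: (congr1 fst (rV_consK x)).
Qed.

Lemma measurable_rV_uncons n : measurable_fun [set: 'rV[R]_n.+1] (@rV_uncons n).
Proof.
apply/measurable_fun_pairP; split; first exact: (measurable_rV_coord 0).
apply: measurable_fun_rV => i.
rewrite (_ : _ \o _ = rV_coord (lift ord0 i)); first exact: measurable_rV_coord.
by apply/funext => x; rewrite /rV_coord /= mxE.
Qed.

Section step.
Variables (n : nat) (m : {sigma_finite_measure set 'rV[R]_n -> \bar R}).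
Local Open Scope ereal_scope.

Definition lebesgue_step : set 'rV[R]_n.+1 -> \bar R :=
  pushforward (@lebesgue_measure R \x m) (@rV_cons n).

Let lebesgue_step0 : lebesgue_step set0 = 0.
Proof. by rewrite /lebesgue_step /pushforward preimage_set0 measure0. Qed.

Let lebesgue_step_ge0 A : 0 <= lebesgue_step A.
Proof. by rewrite /lebesgue_step /pushforward; exact: measure_ge0. Qed.

Let lebesgue_step_sigma_additive : semi_sigma_additive lebesgue_step.
Proof.
have mcons B : measurable B -> measurable (@rV_cons n @^-1` B).
  by move=> mB; rewrite -[X in measurable X]setTI; exact: measurable_rV_cons.
move=> F mF tF mUF; rewrite /lebesgue_step /pushforward preimage_bigcup.
apply: (@measure_semi_sigma_additive _ _ _ (@lebesgue_measure R \x m)).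
- by move=> k; exact: mcons.
- apply/trivIsetP => /= i j _ _ ij; rewrite -preimage_setI.
  by move/trivIsetP : tF => /(_ _ _ _ _ ij) ->//; rewrite preimage_set0.
- by rewrite -preimage_bigcup; exact: mcons.
Qed.

HB.instance Definition _ := isMeasure.Build _ _ _ lebesgue_step
  lebesgue_step0 lebesgue_step_ge0 lebesgue_step_sigma_additive.

Let lebesgue_step_sigma_finite : sigma_finite setT lebesgue_step.
Proof.
have /sigma_finiteP[F [TF ndF Foo]] := sigma_finiteT (@lebesgue_measure R).
have /sigma_finiteP[G [TG ndG Goo]] := sigma_finiteT m.
exists (fun k => @rV_uncons n @^-1` (F k `*` G k)).
  rewrite -preimage_bigcup -[LHS](preimage_setT (@rV_uncons n)); congr (_ @^-1` _).
  apply/esym; rewrite -subTset => -[x y] _.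
  have [i _ Fix] : (\bigcup_i F i) x by rewrite -TF.
  have [j _ Gjy] : (\bigcup_i G i) y by rewrite -TG.
  exists (maxn i j) => //; split.
    by move: x Fix; exact/subsetPset/ndF/leq_maxl.
  by move: y Gjy; exact/subsetPset/ndG/leq_maxr.
move=> k; have [mF Fk] := Foo k; have [mG Gk] := Goo k; split.
  rewrite -[X in measurable X]setTI.
  by apply: measurable_rV_uncons => //; exact: measurableX.
rewrite /lebesgue_step /pushforward -comp_preimage.
rewrite (_ : _ \o _ = id); last by apply/funext => x; exact: rV_consK.
by rewrite preimage_id product_measure1E// lte_mul_pinfty// ge0_fin_numE.
Qed.

HB.instance Definition _ := Measure_isSigmaFinite.Build _ _ _ lebesgue_step
  lebesgue_step_sigma_finite.

End step.

Fixpoint lebesgue_borel n : {sigma_finite_measure set 'rV[R]_n -> \bar R} :=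
  if n is n'.+1 then lebesgue_step (lebesgue_borel n') else dirac (0 : 'rV[R]_0).

End lebesgue_borel.

(* Completing the Borel measure makes the measurable sets the Lebesgue
   measurable ones. *)
Definition lebesgue_rV {R : realType} {n : nat} :=
  @completed_measure_extension _ _ _ (@lebesgue_borel R n).
HB.instance Definition _ (R : realType) n := Measure.on (@lebesgue_rV R n).

Section spaces.
Context {R : realType} {n : nat}.
Local Notation V := 'rV[R]_n.
Local Notation mu := (@lebesgue_rV R n).
Implicit Types (f g : V -> R) (Q S : set V).

(* Cubes are taken open: this choice is immaterial for all the norms below, and
   gives the largest space of locally integrable functions. *)
Definition cube (a : V) (l : R) : set V :=
  [set x | forall i, a 0 i < x 0 i < a 0 i + l].

Definition cubes : set (set V) :=
  [set Q | exists a l, 0 < l /\ Q = cube a l].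

(* the 2 ^ n cubes obtained by halving each side of Q *)
Definition bisection Q : set (set V) :=
  [set S | exists a l (e : 'I_n -> bool), [/\ 0 < l, Q = cube a l &
    S = cube (\row_i (a 0 i + (e i)%:R * (l / 2))) (l / 2)]].

Inductive dyadic Q : set (set V) :=
| dyadic_refl : dyadic Q Q
| dyadic_bisection S T : dyadic Q S -> bisection S T -> dyadic Q T.

(* For p < 1 this is only a quasi-norm. *)
Definition LnormOn (p : R) Q f : \bar R := 'N[mu]_p%:E[(EFin \o f) \_ Q]%E.

Definition average Q f : R := (fine (mu Q))^-1 * (\int[mu]_(x in Q) f x)%R.

(* Partial derivatives of a Lipschitz function exist almost everywhere; where
   one does not, 'D takes an arbitrary value. *)
Definition gradient f (x : V) : V := \row_i 'D_(delta_mx 0 i) f x.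

Definition euclidean_norm (v : V) : R := Num.sqrt (\sum_i v 0 i ^+ 2).

Definition L1loc Q g : Prop :=
  forall K : set V, compact K -> K `<=` Q -> mu.-integrable K (EFin \o g).

Local Open Scope ereal_scope.

Definition morrey_norm (s t rho : R) Q g : \bar R :=
  (\esum_(S in dyadic Q)
     (mu S `^ (s^-1 - t^-1) * LnormOn t S g) `^ rho) `^ rho^-1.

Definition morrey (s t rho : R) Q : set (V -> R) :=
  [set g | L1loc Q g /\ morrey_norm s t rho Q g < +oo].

End spaces.

(* Main.v *)
Require Import Defs.
From HB Require Import structures.
From mathcomp Require Import all_boot all_order all_algebra.
From mathcomp Require Import all_classical all_reals all_analysis.
From mathcomp Require Import measurable_realfun.
From mathcomp Require Import ring lra.
Import Order.TTheory GRing.Theory Num.Theory.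
Import numFieldNormedType.Exports.
Local Open Scope classical_set_scope.
Local Open Scope ring_scope.

(** The theorem holds because the oscillation of [f] on the cube [Q] can be
    summed along the dyadic tree of [Q].

    Write [h = |grad f|], [N] for the dimension, [len R] for the side of a
    dyadic cube [R] and [h_R], [f_R] for averages over [R].  For a child [R'] of
    [R] one has [|f_R' - f_R| <= 2^N * len R * h_R] ([child_average_le]), so
    [|f x - f_Q|] is at most the sum of [2^N * len R * h_R] over the dyadic
    cubes [R] that contain [x], up to an error [K * len R] at the last cube.  As
    a Lipschitz function has a finite constant [K], it is enough to go down
    finitely many levels with bounds independent of the depth.

    What is left is a statement about weights on a finite tree ([tree_bound]).
    Descend from [Q] carrying a level [a], an upper bound for [h_R] up to the
    factor 2.  While [h_R <= 2 a], the terms [len R * h_R] form a geometric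
    series dominated by [a] times the side at which the level was chosen.  When
    [h_R > 2 a], the level jumps to [h_R], and the jump costs a multiple of
    [(len R * h_R)^q * W R], where [W R = |R|^(1 - q/t) * ||g||_{L^t(R)}^q],
    with [t = r] if [q > 1] and [t = q] otherwise, bounds the integral of
    [|g|^q] over [R].  By the relation between [p], [q], [s] and the dimension,
    this cost equals
    [(|R| * h_R^p)^(q/p) * z_R^(q/rho)] with [z_R] the summand of the Morrey
    norm at [R].  As [q/p + q/rho = 1], Hoelder's inequality for sums leaves two
    sums over the jump cubes: that of [z_R], at most a power of the Morrey norm,
    and that of [|R| * h_R^p].  The latter is the bound usually taken from the
    maximal theorem.  Here it comes from the potential
    [Psi R a = c0^p * int_R h^p + a^p * |R| - c0 * a^(p-1) * int_R h], which is
    nonnegative by Young's inequality, is additive over children, and drops by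
    at least [|R| * h_R^p] at each jump.

    It remains to see that the jumps below a given jump do not multiply the
    constants.  For [q <= 1] this follows from [(S + x)^q <= S^q + x^q].  For
    [q < t] the estimate [(S + x)^q <= (1 + eps) * S^q + A * x^q] is used, with
    [eps] small and [A] depending on it, and the factor [1 + eps]
    is absorbed by the weight [tree_weight], which bounds the integral of
    [|g|^q] and contains the term [(int_R h / (2 a))^(1 - q/t)]; a jump at least
    doubles [a], so this term decreases by a fixed factor.

    The inequality for [f_R' - f_R] is proved by shrinking [R] to [R'] one
    coordinate at a time.  Each step is, by Tonelli's theorem, an inequality on
    lines ([line_integral_compare]), which follows from
    [|phi b - phi a| <= int |phi'|] for a Lipschitz function [phi] on the line
    ([lipschitz_le_integral]).  This last fact follows from the Radon-Nikodym
    and Lebesgue differentiation theorems, applied to the Stieltjes measure of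
    the nondecreasing function [K * x + phi x].

    Finally, a Lipschitz function on [Q] is extended to the whole space and made
    nonnegative by adding a constant, neither of which changes
    [f - f_Q] or the gradient on the open cube [Q] ([norm_estimate]). *)

Set Implicit Arguments.
Unset Strict Implicit.
Unset Printing Implicit Defensive.

(** * Inequalities for real powers *)

Section powR_inequalities.
Context {R : realType}.
Implicit Types a b p q x y : R.

Lemma ler_powR_base (e x y : R) : 0 <= e -> 0 <= x -> x <= y -> x `^ e <= y `^ e.
Proof.
by move=> e0 x0 xy; apply: ge0_ler_powR; rewrite ?nnegrE// (le_trans x0).
Qed.

Lemma hoelder_pair a b x1 x2 y1 y2 : 0 < a -> 0 < b -> a + b = 1 ->
  0 <= x1 -> 0 <= x2 -> 0 <= y1 -> 0 <= y2 ->
  x1 `^ a * y1 `^ b + x2 `^ a * y2 `^ b <= (x1 + x2) `^ a * (y1 + y2) `^ b.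
Proof.
move=> a0 b0 ab x10 x20 y10 y20.
have := @hoelder2 R (x1 `^ a) (x2 `^ a) (y1 `^ b) (y2 `^ b) a^-1 b^-1.
rewrite !powR_ge0 !invr_gt0 !invrK -!powRrM !mulfV ?gt_eqF// !powRr1//.
exact.
Qed.

Lemma hoelder_sum (I : finType) a b (x y : I -> R) : 0 < a -> 0 < b ->
  a + b = 1 -> (forall i, 0 <= x i) -> (forall i, 0 <= y i) ->
  \sum_i (x i) `^ a * (y i) `^ b <= (\sum_i x i) `^ a * (\sum_i y i) `^ b.
Proof.
move=> a0 b0 ab x0 y0.
suff : [/\ 0 <= \sum_i x i, 0 <= \sum_i y i & \sum_i (x i) `^ a * (y i) `^ b <=
    (\sum_i x i) `^ a * (\sum_i y i) `^ b] by case.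
elim/big_rec3: _ => [|i z2 z1 z0 _ [z20 z10 h]].
  by rewrite powR0 ?gt_eqF// mul0r.
split; rewrite ?addr_ge0//.
by apply: le_trans (hoelder_pair a0 b0 ab (x0 i) z20 (y0 i) z10); rewrite lerD2l.
Qed.

(** By concavity [z^q >= z / (x + y) * (x + y)^q] when [0 <= z <= x + y]; add this
    up for [z = x] and [z = y]. *)
Lemma powR_subadditive q x y : 0 < q -> q <= 1 -> 0 <= x -> 0 <= y ->
  (x + y) `^ q <= x `^ q + y `^ q.
Proof.
move=> q0 q1 x0 y0; have [xy0|xy0] := eqVneq (x + y) 0.
  by rewrite xy0 powR0 ?gt_eqF// addr_ge0// powR_ge0.
have xyp : 0 < x + y by rewrite lt_neqAle eq_sym xy0 addr_ge0.
have H z : 0 <= z -> z <= x + y -> z / (x + y) * (x + y) `^ q <= z `^ q.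
  move=> z0 zxy; have -> : z `^ q = (z / (x + y)) `^ q * (x + y) `^ q.
    by rewrite -powRM ?divr_ge0 ?(ltW xyp)// divfK// gt_eqF.
  rewrite ler_wpM2r ?powR_ge0//.
  have [->|zn0] := eqVneq z 0; first by rewrite mul0r powR_ge0.
  apply: ger1_powR => //; rewrite divr_gt0//=; last by rewrite lt_neqAle eq_sym zn0.
  by rewrite ler_pdivrMr// mul1r.
rewrite -[leLHS]mul1r -(divff xy0) {1}mulrDl mulrDl.
by apply: lerD; apply: H; rewrite ?lerDl ?lerDr.
Qed.

(** The factor in front of [x^q] is [B / (B - 1)], which may be as close to 1 as
    one likes: if [y <= e * x] for a small [e] the sum is at most
    [((1 + e) * x)^q], and otherwise it is a multiple of [y^q]. *)
Lemma powRD_weighted q B : 0 < q -> 1 < B ->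
  exists2 A, 0 <= A & forall x y, 0 <= x -> 0 <= y ->
    (x + y) `^ q * (B - 1) <= B * x `^ q + A * y `^ q.
Proof.
move=> q0 B1; have B10 : 0 < B - 1 by rewrite subr_gt0.
have B0 : 0 < B by rewrite (lt_trans _ B1).
pose e := (B / (B - 1)) `^ q^-1 - 1.
have e0 : 0 < e.
  rewrite subr_gt0 -[ltLHS](_ : 1 `^ q^-1 = 1); last by rewrite powR1.
  apply: gt0_ltr_powR; rewrite ?invr_gt0 ?nnegrE ?divr_ge0 ?ltW//.
  by rewrite ltr_pdivlMr//; lra.
have e1 : (1 + e) `^ q = B / (B - 1).
  rewrite /e addrC subrK -powRrM mulVf ?gt_eqF// powRr1//.
  by rewrite divr_ge0// ltW.
clearbody e.
exists ((e^-1 + 1) `^ q * (B - 1)); first by rewrite mulr_ge0 ?powR_ge0// ltW.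
move=> x y x0 y0; have [yx|/ltW yx] := leP y (e * x).
  apply: (@le_trans _ _ (B * x `^ q)); last first.
    by rewrite lerDl !mulr_ge0 ?powR_ge0// ltW.
  apply: (@le_trans _ _ (((1 + e) * x) `^ q * (B - 1))).
    rewrite ler_wpM2r ?(ltW B10)// ler_powR_base ?(ltW q0) ?addr_ge0//.
    by rewrite mulrDl mul1r lerD2l.
  rewrite powRM ?addr_ge0 ?(ltW e0)//.
  by rewrite e1 mulrAC divfK ?gt_eqF// mulrC.
apply: (@le_trans _ _ ((e^-1 + 1) `^ q * (B - 1) * y `^ q)); last first.
  by rewrite lerDr mulr_ge0 ?powR_ge0// ltW.
rewrite mulrAC ler_wpM2r ?(ltW B10)// -powRM ?addr_ge0 ?invr_ge0 ?(ltW e0)//.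
rewrite ler_powR_base ?(ltW q0) ?addr_ge0// mulrDl mul1r lerD2r.
by rewrite mulrC ler_pdivlMr// mulrC.
Qed.

(** Compare [E * h] with [a]: the larger of the two makes the left side at most
    its own [p]-th power. *)
Lemma young_powR p E a h : 1 < p -> 0 <= E -> 0 <= a -> 0 <= h ->
  E * a `^ (p - 1) * h <= E `^ p * h `^ p + a `^ p.
Proof.
move=> p1 E0 a0 h0; have p0 : 0 < p by rewrite (lt_trans _ p1).
have p10 : 0 <= p - 1 by rewrite subr_ge0 ltW.
have Eh : 0 <= E * h by rewrite mulr_ge0.
rewrite -powRM//; have [le|/ltW le] := leP (E * h) a.
  apply: (@le_trans _ _ (a `^ p)); last by rewrite lerDr powR_ge0.
  by rewrite -(mulr_powRB1 a0 p0) mulrAC ler_wpM2r ?powR_ge0.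
apply: (@le_trans _ _ ((E * h) `^ p)); last by rewrite lerDl powR_ge0.
rewrite -(mulr_powRB1 Eh p0) mulrAC ler_wpM2l// ler_powR_base//.
Qed.

End powR_inequalities.

(** * The level argument on a dyadic tree *)

Section dyadic_tree.
Context {R : realType} {I : finType} {cell : Type}.
Variable ch : cell -> I -> cell.

Fixpoint treesum (z : cell -> R) (d : nat) (c : cell) : R :=
  z c + (if d is d'.+1 then \sum_i treesum z d' (ch c i) else 0).

Lemma treesum_ge0 z d c : (forall c, 0 <= z c) -> 0 <= treesum z d c.
Proof.
move=> z0; elim: d c => [|d IH] c /=; first by rewrite addr0.
by rewrite addr_ge0 ?sumr_ge0.
Qed.

Variables (n : nat) (p q s rho t : R).
Hypotheses (n_gt0 : (0 < n)%N) (p_gt1 : 1 < p) (q_gt0 : 0 < q) (s_gt0 : 0 < s)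
  (rho_gt0 : 0 < rho) (t_gt0 : 0 < t).
Hypothesis pq_rho : q^-1 = p^-1 + rho^-1.
Hypothesis pq_s : q^-1 = p^-1 + s^-1 - n%:R^-1.

(* On a cube [c], the numbers [H c], [Hp c], [Gq c], [Gt c] stand for the
   integrals of [h], [h^p], [|g|^q], [|g|^t], and [L c T] for the integral of
   [|g|^q * (|f - f_c| + T)^q]; [V c a] is the weight that controls [Gq c] when
   the current level is [a]. *)
Variables (len H Hp Gq Gt : cell -> R) (L V : cell -> R -> R) (D K A0 A1 : R).

Let vol c := len c ^+ n.
Let avg c := H c / vol c.
Let W c := vol c `^ (1 - q / t) * Gt c `^ (q / t).

(** The summand at [c] of the [rho]-th power of the Morrey norm, with [Gt c] in
    the role of the integral of [|g|^t] over [c]. *)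
Definition morrey_term c := (vol c `^ (s^-1 - t^-1) * Gt c `^ t^-1) `^ rho.
Local Notation z := morrey_term.

Hypotheses (D_ge0 : 0 <= D) (K_ge0 : 0 <= K) (A0_ge0 : 0 <= A0) (A1_ge0 : 0 <= A1).
Hypotheses (len_gt0 : forall c, 0 < len c) (H_ge0 : forall c, 0 <= H c)
  (Hp_ge0 : forall c, 0 <= Hp c) (Gq_ge0 : forall c, 0 <= Gq c)
  (Gt_ge0 : forall c, 0 <= Gt c).
Hypotheses (len_ch : forall c i, len (ch c i) = len c / 2)
  (vol_ch : forall c, \sum_i vol (ch c i) = vol c)
  (H_ch : forall c, \sum_i H (ch c i) = H c)
  (Hp_ch : forall c, \sum_i Hp (ch c i) = Hp c).
Hypothesis Gq_ch : forall c, \sum_i Gq (ch c i) = Gq c.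
Hypothesis young : forall c (E a : R), 0 <= E -> 0 <= a ->
  E * a `^ (p - 1) * H c <= E `^ p * Hp c + a `^ p * vol c.
Hypothesis L_step : forall c (T T' : R), 0 <= T -> T + D * len c * avg c <= T' ->
  L c T <= \sum_i L (ch c i) T'.
Hypothesis L_leaf : forall c (T : R), 0 <= T -> L c T <= (T + K * len c) `^ q * Gq c.
Hypothesis V_ch : forall c (a : R), 0 < a -> \sum_i V (ch c i) a <= V c a.
Hypothesis V_ge : forall c (a : R), 0 < a -> Gq c <= V c a.
Hypothesis V_jump : forall c (a S b : R), 0 < a -> 2 * a < avg c -> 0 <= S -> 0 <= b ->
  (S + b) `^ q * V c (avg c) <= S `^ q * V c a + A0 * b `^ q * W c.
Hypothesis V_start : forall c, 0 < avg c -> V c (avg c) <= A1 * W c.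

Let p_gt0 : 0 < p. Proof. by rewrite (lt_trans _ p_gt1). Qed.
Let vol_gt0 c : 0 < vol c. Proof. by rewrite exprn_gt0. Qed.
Let avg_ge0 c : 0 <= avg c. Proof. by rewrite divr_ge0// ltW. Qed.
Let HE c : H c = avg c * vol c. Proof. by rewrite divfK// gt_eqF. Qed.
Let z_ge0 c : 0 <= z c. Proof. exact: powR_ge0. Qed.

Let al_gt0 : 0 < q / p. Proof. by rewrite divr_gt0. Qed.
Let be_gt0 : 0 < q / rho. Proof. by rewrite divr_gt0. Qed.
Let al_be : q / p + q / rho = 1.
Proof. by rewrite -mulrDr -pq_rho mulfV// gt_eqF. Qed.

(* The value for which [c0 * (1 - 2^(1-p)) = 2]: a jump at least doubles the
   level, so the last term of [Psi] below then gains twice [vol c * avg c ^ p],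
   once to pay the jump and once for the growth of [a ^ p * vol c]. *)
Let c0 : R := 2 / (1 - 2^-1 `^ (p - 1)).

Let half_lt1 : 2^-1 `^ (p - 1) < 1 :> R.
Proof.
rewrite -[ltRHS](_ : 1 `^ (p - 1) = 1); last by rewrite powR1.
by apply: gt0_ltr_powR; rewrite ?subr_gt0 ?nnegrE//; lra.
Qed.

Let c0_ge2 : 2 <= c0.
Proof.
have h0 : 0 <= 2^-1 `^ (p - 1) :> R := powR_ge0 _ _.
by rewrite /c0 ler_pdivlMr ?subr_gt0//; lra.
Qed.

Let Psi c a := c0 `^ p * Hp c + a `^ p * vol c - c0 * a `^ (p - 1) * H c.

Let Psi_ge0 c a : 0 <= a -> 0 <= Psi c a.
Proof. by move=> a0; rewrite subr_ge0 young// (le_trans _ c0_ge2). Qed.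

Let Psi_ch c a : \sum_i Psi (ch c i) a = Psi c a.
Proof.
rewrite /Psi big_split big_split/= sumrN -!mulr_sumr.
by rewrite H_ch Hp_ch vol_ch.
Qed.

(** In terms of the average [h] the claim reads
    [2 * h^p <= a^p + c0 * (h^(p-1) - a^(p-1)) * h], where
    [a^(p-1) <= 2^(1-p) * h^(p-1)]. *)
Let Psi_jump c a : 0 < a -> 2 * a < avg c ->
  vol c * avg c `^ p + Psi c (avg c) <= Psi c a.
Proof.
move=> a0 ah; rewrite /Psi HE.
set h := avg c in ah *; have h0 : 0 < h by rewrite (lt_trans _ ah)// mulr_gt0.
have hp : h * h `^ (p - 1) = h `^ p by rewrite mulr_powRB1// ltW.
have hap : a `^ (p - 1) <= 2^-1 `^ (p - 1) * h `^ (p - 1).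
  rewrite -powRM ?(ltW h0)// ler_powR_base ?subr_ge0 ?(ltW p_gt1) ?(ltW a0)//; lra.
suff : 2 * h `^ p <= a `^ p + c0 * (h `^ (p - 1) - a `^ (p - 1)) * h.
  move=> /(ler_wpM2r (ltW (vol_gt0 c))); rewrite -hp.
  by set v := vol c; lra.
have : 2 * h `^ p <= c0 * (h `^ (p - 1) - a `^ (p - 1)) * h.
  rewrite -hp [h * _]mulrC mulrA ler_wpM2r ?(ltW h0)//.
  have -> : 2 * h `^ (p - 1) = c0 * (h `^ (p - 1) - 2^-1 `^ (p - 1) * h `^ (p - 1)).
    rewrite -{2}[h `^ (p - 1)]mul1r -mulrBl mulrA /c0 divfK//.
    by rewrite gt_eqF// subr_gt0.
  by rewrite ler_wpM2l ?(le_trans _ c0_ge2)// lerB.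
by move=> /le_trans; apply; rewrite lerDr powR_ge0.
Qed.

(** Both sides contain the same power of [l]: this is what the relation between
    [p], [q], [s] and [n] says. *)
Let scaling b l h v G : 0 <= b -> 0 < l -> 0 <= h -> v = l ^+ n ->
  (b * l * h) `^ q * (v `^ (1 - q / t) * G `^ (q / t)) =
  b `^ q * (v * h `^ p) `^ (q / p) *
    ((v `^ (s^-1 - t^-1) * G `^ t^-1) `^ rho) `^ (q / rho).
Proof.
move=> b0 l0 h0 vE; have l0' := ltW l0.
have v0 : 0 < v by rewrite vE exprn_gt0.
have lE : l = v `^ n%:R^-1.
  rewrite vE -powR_mulrn ?(ltW l0)// -powRrM mulfV ?powRr1 ?(ltW l0)//.
  by rewrite pnatr_eq0 -lt0n.
rewrite (powRM _ (mulr_ge0 b0 l0') h0) (powRM _ b0 l0').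
have -> : ((v `^ (s^-1 - t^-1) * G `^ t^-1) `^ rho) `^ (q / rho) =
    v `^ (q * s^-1 - q / t) * G `^ (q / t).
  rewrite -powRrM (powRM _ (powR_ge0 _ _) (powR_ge0 _ _)) -!powRrM.
  by congr (_ `^ _ * _ `^ _); field; rewrite !gt_eqF.
have -> : (v * h `^ p) `^ (q / p) = v `^ (q / p) * h `^ q.
  rewrite (powRM _ (ltW v0) (powR_ge0 _ _)) -powRrM.
  by congr (_ * _ `^ _); rewrite mulrC divfK// gt_eqF.
rewrite lE -powRrM.
suff vE' : v `^ (n%:R^-1 * q) * v `^ (1 - q / t) =
    v `^ (q / p) * v `^ (q * s^-1 - q / t).
  rewrite -!mulrA; congr (_ * _); rewrite [LHS]mulrCA [RHS]mulrCA; congr (_ * _).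
  by rewrite mulrA vE' -mulrA.
have vn0 : v != 0 by rewrite gt_eqF.
rewrite -!powRD ?vn0 ?implybT//; congr (_ `^ _).
have : q * (q^-1) = q * (p^-1 + s^-1 - n%:R^-1) by rewrite pq_s.
rewrite mulfV ?gt_eqF//; lra.
Qed.

Let jump_term c b : 0 <= b ->
  (b * len c * avg c) `^ q * W c =
  b `^ q * (vol c * avg c `^ p) `^ (q / p) * z c `^ (q / rho).
Proof. by move=> b0; exact: scaling. Qed.

Let A := A0 * (3 * D) `^ q.

Let A_ge0 : 0 <= A. Proof. by rewrite mulr_ge0 ?powR_ge0. Qed.

(** Induction on the depth, with three terms to carry: [Psi], which pays for the
    jumps still to come; [4 * D * a * len c], an upper bound for the geometric
    series of the steps made at level [a]; and the oscillation
    [K * len c / 2^d] left at the bottom. *)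
Lemma tree_level_bound d c a T : 0 < a -> 0 <= T ->
  L c T <= A * (Psi c a `^ (q / p) * treesum z d c `^ (q / rho)) +
    (T + 4 * D * a * len c + K * len c / 2 ^+ d) `^ q * V c a.
Proof.
elim: d c a T => [|d IH] c a T a0 T0; have l0 := ltW (len_gt0 c).
  apply: (le_trans (L_leaf c T0)); rewrite expr0 divr1.
  have D0 : 0 <= 4 * D * a * len c by rewrite !mulr_ge0 ?(ltW a0).
  rewrite -[leLHS]add0r lerD// ?mulr_ge0 ?powR_ge0//.
  rewrite ler_pM ?powR_ge0 ?V_ge// ler_powR_base ?(ltW q_gt0) ?addr_ge0 ?mulr_ge0//.
  lra.
have D0 : 0 <= 4 * D * a * len c by rewrite !mulr_ge0 ?(ltW a0).
have K0 : 0 <= K * len c / 2 ^+ d.+1 by rewrite divr_ge0 ?mulr_ge0 ?exprn_ge0.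
set S := T + _ + _; have S0 : 0 <= S by rewrite !addr_ge0.
have tsum a' : 0 <= a' ->
    \sum_i Psi (ch c i) a' `^ (q / p) * treesum z d (ch c i) `^ (q / rho) <=
    Psi c a' `^ (q / p) * (\sum_i treesum z d (ch c i)) `^ (q / rho).
  move=> a'0; rewrite -(Psi_ch c a'); apply: hoelder_sum => // i.
    exact: Psi_ge0.
  exact: treesum_ge0.
have [ha|ha] := leP (avg c) (2 * a).
  (* The step costs [2 D a len c]; the children, of half the side, need another
     [4 D a (len c / 2)], for a total of [4 D a len c]. *)
  pose T' := T + 2 * D * a * len c.
  have TT' : T + D * len c * avg c <= T'.
    have := ler_wpM2l (mulr_ge0 D_ge0 l0) ha; rewrite /T'; lra.
  have T'0 : 0 <= T' by rewrite addr_ge0// !mulr_ge0// ltW.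
  apply: le_trans (L_step T0 TT') _.
  apply: le_trans (ler_sum _ (fun i _ => IH (ch c i) a T' a0 T'0)) _.
  under eq_bigr do rewrite len_ch.
  have -> : T' + 4 * D * a * (len c / 2) + K * (len c / 2) / 2 ^+ d = S.
    rewrite /S /T' exprS; field; exact: expf_neq0.
  rewrite big_split/= -!mulr_sumr lerD//; last by rewrite ler_wpM2l ?powR_ge0 ?V_ch.
  rewrite ler_wpM2l//; apply: le_trans (tsum _ (ltW a0)) _.
  rewrite ler_wpM2l ?powR_ge0// ler_powR_base ?(ltW be_gt0)//.
    by rewrite sumr_ge0// => i _; exact: treesum_ge0.
  by rewrite /= lerDr.
(* A jump: the step and the series at the new level [h] need
   [D len c h + 4 D h (len c / 2)], the [b] below. *)
pose h := avg c; have h0 : 0 < h by rewrite (lt_trans _ ha)// mulr_gt0.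
pose T' := T + D * len c * h.
have T'0 : 0 <= T' := addr_ge0 T0 (mulr_ge0 (mulr_ge0 D_ge0 l0) (ltW h0)).
apply: le_trans (L_step T0 (lexx T')) _.
apply: le_trans (ler_sum _ (fun i _ => IH (ch c i) h T' h0 T'0)) _.
under eq_bigr do rewrite len_ch.
pose b := 3 * D * len c * h.
have b0 : 0 <= b.
  by apply: mulr_ge0 (ltW h0); rewrite !mulr_ge0.
have SE : T' + 4 * D * h * (len c / 2) + K * (len c / 2) / 2 ^+ d <= S + b.
  have -> : K * (len c / 2) / 2 ^+ d = K * len c / 2 ^+ d.+1.
    rewrite exprS; field; exact: expf_neq0.
  by rewrite /S /T' /b; lra.
have Vh0 : 0 <= V c h by exact: le_trans (Gq_ge0 c) (V_ge c h0).
rewrite big_split/= -!mulr_sumr.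
apply: (@le_trans _ _ (A * (Psi c h `^ (q / p) *
    (\sum_i treesum z d (ch c i)) `^ (q / rho)) + (S + b) `^ q * V c h)).
  apply: lerD; first by rewrite ler_wpM2l// tsum// ltW.
  apply: ler_pM; rewrite ?powR_ge0 ?V_ch//.
    by apply: sumr_ge0 => i _; apply: le_trans (Gq_ge0 _) (V_ge _ h0).
  apply: ler_powR_base => //; first exact: ltW.
  apply: addr_ge0.
    apply: addr_ge0 => //; apply: mulr_ge0; last by rewrite divr_ge0.
    by apply: mulr_ge0 (ltW h0); rewrite mulr_ge0.
  by rewrite divr_ge0 ?mulr_ge0 ?exprn_ge0 ?divr_ge0.
apply: le_trans (lerD (lexx _) (V_jump a0 ha S0 b0)) _.
rewrite -mulrA (@jump_term c (3 * D)) ?mulr_ge0// addrCA [leRHS]addrC lerD2l.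
rewrite -/h [A0 * _]mulrA [A0 * _]mulrA -/A -[A * _ * _]mulrA -mulrDr ler_wpM2l//.
set P := vol c * h `^ p.
have P0 : 0 <= P by rewrite mulr_ge0 ?powR_ge0// ltW.
have Z0 : 0 <= \sum_i treesum z d (ch c i).
  by apply: sumr_ge0 => i _; exact: treesum_ge0.
rewrite addrC.
apply: le_trans
  (hoelder_pair al_gt0 be_gt0 al_be P0 (Psi_ge0 c (ltW h0)) (z_ge0 c) Z0) _.
rewrite ler_wpM2r ?powR_ge0// ler_powR_base ?(ltW al_gt0)//.
  exact: addr_ge0 P0 (Psi_ge0 c (ltW h0)).
exact: Psi_jump.
Qed.

Lemma exists_div_exp2_le (x y : R) : 0 < y -> exists d, x / 2 ^+ d <= y.
Proof.
move=> y0; exists (Num.bound (x / y)).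
have xy : x / y <= (Num.bound (x / y))%:R.
  have [xy0|/ltW xy0] := leP 0 (x / y); first exact/ltW/archi_boundP.
  by rewrite (le_trans xy0).
rewrite ler_pdivrMr ?exprn_gt0// mulrC -ler_pdivrMr// (le_trans xy)//.
by rewrite -natrX ler_nat ltnW// ltn_expl.
Qed.

(** Where [h] vanishes no positive level is available to start from, but then
    all the averages of [f] below [c] coincide. *)
Let L_flat d c T : H c = 0 -> 0 <= T ->
  L c T <= (T + K * len c / 2 ^+ d) `^ q * Gq c.
Proof.
elim: d c T => [|d IH] c T Hc T0.
  by rewrite expr0 divr1; exact: L_leaf.
have Hi i : H (ch c i) = 0.
  have := H_ch c; rewrite Hc => /psumr_eq0P.
  by apply => // j _; exact: H_ge0.
have TT : T + D * len c * avg c <= T by rewrite /avg Hc mul0r mulr0 addr0.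
apply: le_trans (L_step T0 TT) _.
apply: le_trans (ler_sum _ (fun i _ => IH (ch c i) T (Hi i) T0)) _.
under eq_bigr do rewrite len_ch.
rewrite -mulr_sumr Gq_ch.
have -> // : K * (len c / 2) / 2 ^+ d = K * len c / 2 ^+ d.+1.
by rewrite exprS; field; exact: expf_neq0.
Qed.

Definition tree_const := (A + A1 * (4 * D + 1) `^ q) * (2 * c0 `^ p) `^ (q / p).

Lemma tree_const_ge0 : 0 <= tree_const.
Proof.
apply: mulr_ge0 (powR_ge0 _ _).
by rewrite addr_ge0 ?(mulr_ge0 A1_ge0) ?powR_ge0.
Qed.

(** Start at the level [avg c], at a depth where the remaining oscillation
    [K / 2^d] is at most this level, so that it adds only 1 to the factor
    [4 * D]. *)
Theorem tree_bound c Z : (forall d, treesum z d c <= Z) ->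
  L c 0 <= tree_const * (Hp c `^ (q / p) * Z `^ (q / rho)).
Proof.
move=> cZ; have Z0 : 0 <= Z := le_trans (treesum_ge0 0 c z_ge0) (cZ 0).
have c0p : 0 <= c0 `^ p := powR_ge0 _ _.
have D41 : 0 <= 4 * D + 1 by rewrite addr_ge0 ?mulr_ge0.
have tc0 := tree_const_ge0.
have [h0|] := ltP 0 (avg c); last first.
  move=> h0; have {}h0 : avg c = 0 by apply/le_anti/andP.
  have Hc : H c = 0 by rewrite HE h0 mul0r.
  apply: (@le_trans _ _ 0); last first.
    by apply: mulr_ge0 tc0 _; rewrite mulr_ge0 ?powR_ge0.
  apply/ler_addgt0Pr => e e0; rewrite add0r.
  have G0 : 0 < Gq c + 1 by rewrite ltr_wpDl.
  have [d hd] := exists_div_exp2_le (K * len c) (powR_gt0 q^-1 (divr_gt0 e0 G0)).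
  apply: le_trans (L_flat d Hc (lexx 0)) _; rewrite add0r.
  apply: (@le_trans _ _ (e / (Gq c + 1) * Gq c)).
    rewrite ler_wpM2r//.
    have -> : e / (Gq c + 1) = ((e / (Gq c + 1)) `^ q^-1) `^ q.
      by rewrite -powRrM mulVf ?gt_eqF// powRr1// divr_ge0 ?ltW.
    by rewrite ler_powR_base ?(ltW q_gt0) ?divr_ge0 ?mulr_ge0 ?exprn_ge0
      ?(ltW (len_gt0 c)).
  by rewrite mulrAC ler_pdivrMr// ler_wpM2l ?(ltW e0)// lerDl.
have [d hd] := exists_div_exp2_le K h0.
apply: le_trans (tree_level_bound d c h0 (lexx 0)) _.
have l0 := ltW (len_gt0 c); have h0' := ltW h0.
have hp : vol c * avg c `^ p <= c0 `^ p * Hp c.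
  have := @young c c0 (avg c) (le_trans (ler0n _ 2) c0_ge2) h0'.
  rewrite HE -[c0 * _ * _]mulrA (mulrA _ (avg c)) (mulrC _ (avg c)) mulr_powRB1//.
  have : 0 <= (c0 - 2) * (avg c `^ p * vol c).
    by rewrite mulr_ge0 ?subr_ge0// mulr_ge0 ?powR_ge0 ?(ltW (vol_gt0 c)).
  lra.
have PsiM : Psi c (avg c) <= 2 * c0 `^ p * Hp c.
  have : 0 <= c0 * avg c `^ (p - 1) * H c.
    apply: mulr_ge0 (H_ge0 c); apply: mulr_ge0 (powR_ge0 _ _).
    exact: le_trans (ler0n _ 2) c0_ge2.
  rewrite /Psi; lra.
have M0 : 0 <= 2 * c0 `^ p by rewrite mulr_ge0.
have hpM : vol c * avg c `^ p <= 2 * c0 `^ p * Hp c.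
  by apply: le_trans hp _; rewrite ler_wpM2r// ler_peMl//; lra.
rewrite /tree_const; move: (2 * c0 `^ p) M0 PsiM hpM => M M0 PsiM hpM.
have ME : M `^ (q / p) * (Hp c `^ (q / p) * Z `^ (q / rho)) =
    (M * Hp c) `^ (q / p) * Z `^ (q / rho).
  by rewrite (powRM _ M0 (Hp_ge0 c)) mulrA.
have powM (x y : R) : 0 <= x -> x <= M * Hp c -> 0 <= y -> y <= Z ->
    x `^ (q / p) * y `^ (q / rho) <= (M * Hp c) `^ (q / p) * Z `^ (q / rho).
  move=> x0 xM y0 yZ; apply: ler_pM; rewrite ?powR_ge0//.
    by apply: ler_powR_base => //; exact: ltW.
  by apply: ler_powR_base => //; exact: ltW.
rewrite -[leRHS]mulrA ME [leRHS]mulrDl; apply: lerD.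
  apply: (ler_wpM2l A_ge0); apply: powM => //; first exact: Psi_ge0.
  exact: treesum_ge0.
rewrite add0r.
apply: (@le_trans _ _ (((4 * D + 1) * len c * avg c) `^ q * (A1 * W c))).
  apply: ler_pM; rewrite ?powR_ge0 ?V_start//.
    exact: le_trans (Gq_ge0 c) (V_ge c h0).
  apply: ler_powR_base; first exact: ltW.
    apply: addr_ge0; last by rewrite divr_ge0 ?mulr_ge0 ?exprn_ge0.
    apply: mulr_ge0 l0; apply: mulr_ge0 h0'; rewrite ?mulr_ge0//.
  have : len c * (K / 2 ^+ d) <= len c * avg c by rewrite ler_wpM2l.
  lra.
rewrite mulrCA -[leRHS]mulrA; apply: (ler_wpM2l A1_ge0).
rewrite (jump_term c D41) -[leLHS]mulrA; apply: (ler_wpM2l (powR_ge0 _ _)).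
apply: powM => //; first exact: mulr_ge0 (ltW (vol_gt0 c)) (powR_ge0 _ _).
by apply: le_trans (cZ 0); rewrite /= addr0.
Qed.

End dyadic_tree.

(** * A weight that absorbs the factors at the jumps *)

Section tree_weight.
Context {R : realType}.
Variables q t : R.
Hypotheses (q_gt0 : 0 < q) (q_lt_t : q < t).

Let t_gt0 : 0 < t. Proof. by rewrite (lt_trans q_gt0). Qed.
Let b : R := q / t.
Let b_gt0 : 0 < b. Proof. by rewrite divr_gt0. Qed.
Let b_lt1 : 0 < 1 - b. Proof. by rewrite subr_gt0 ltr_pdivrMr// mul1r. Qed.
Let th : R := 2^-1 `^ (1 - b).
Let th_lt1 : 0 < 1 - th.
Proof.
rewrite subr_gt0 -[ltRHS](_ : 1 `^ (1 - b) = 1); last by rewrite powR1.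
by apply: gt0_ltr_powR; rewrite ?nnegrE//; lra.
Qed.

(** The solution of [B * th + 1 = B - 1], [th] being the factor by which the first
    term of [tree_weight] shrinks when the level doubles. *)
Definition weight_const : R := 2 / (1 - th).
Local Notation B := weight_const.

(** The cubes with average above [2 * a] inside a cube where [h] has integral [H]
    occupy a volume of at most [H / (2 * a)]; by Hoelder's inequality the first
    term thus bounds the integral of [|g|^q] over their union. *)
Definition tree_weight (H G Gq a : R) : R :=
  B * ((H / (2 * a)) `^ (1 - b) * G `^ b) + Gq.

Lemma weight_const_gt1 : 1 < B.
Proof.
have h0 : 0 <= th := powR_ge0 _ _.
by rewrite /B ltr_pdivlMr//; lra.
Qed.

Let B_ge0 : 0 <= B. Proof. by rewrite ltW// (lt_trans _ weight_const_gt1). Qed.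

Let BE : B * th + 1 = B - 1.
Proof.
have : B * (1 - th) = 2 by rewrite /B divfK// gt_eqF.
by move: B => B'; lra.
Qed.

Lemma tree_weight_start v h G Gq : 0 < v -> 0 < h -> 0 <= G ->
  Gq <= v `^ (1 - b) * G `^ b ->
  tree_weight (h * v) G Gq h <= (B - 1) * (v `^ (1 - b) * G `^ b).
Proof.
move=> v0 h0 G0 GW; rewrite /tree_weight.
have -> : h * v / (2 * h) = 2^-1 * v by field; rewrite gt_eqF.
rewrite powRM ?(ltW v0)// -/th -[th * _ * _]mulrA mulrA -BE mulrDl mul1r.
by rewrite lerD2l.
Qed.

(** [A] bounds the cost of raising the level from [a] to the average [h] in a cube
    of volume [v], when the oscillation grows from [S] to [S + x]. *)
Definition jump_const A := forall v h G Gq a S x,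
  0 < v -> 0 < a -> 2 * a < h -> 0 <= G -> 0 <= Gq ->
  Gq <= v `^ (1 - b) * G `^ b -> 0 <= S -> 0 <= x ->
  (S + x) `^ q * tree_weight (h * v) G Gq h <=
  S `^ q * tree_weight (h * v) G Gq a + A * x `^ q * (v `^ (1 - b) * G `^ b).

(** Just after the jump the weight is at most [B - 1] times
    [v^(1 - q/t) * G^(q/t)], and just before it is at least [B] times this. The
    ratio [B / (B - 1)] is the room needed by [powRD_weighted]. *)
Lemma exists_jump_const : exists2 A, 0 <= A & jump_const A.
Proof.
have [A A0 hA] := powRD_weighted q_gt0 weight_const_gt1; exists A => //.
move=> v h G Gq a S x v0 a0 ah G0 Gq0 GW S0 x0.
have h0 : 0 < h by rewrite (lt_trans _ ah)// mulr_gt0.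
have W0 : 0 <= v `^ (1 - b) * G `^ b by rewrite mulr_ge0 ?powR_ge0.
apply: le_trans (ler_wpM2l (powR_ge0 _ _) (tree_weight_start v0 h0 G0 GW)) _.
rewrite [leLHS]mulrA; apply: le_trans (ler_wpM2r W0 (hA _ _ S0 x0)) _.
rewrite mulrDl lerD2r mulrAC mulrC ler_wpM2l ?powR_ge0// /tree_weight.
apply: (@le_trans _ _ (B * ((h * v / (2 * a)) `^ (1 - b) * G `^ b))); last first.
  by rewrite lerDl.
rewrite ler_wpM2l// ler_wpM2r ?powR_ge0// ler_powR_base ?(ltW b_lt1) ?(ltW v0)//.
have a20 : 0 < 2 * a by rewrite mulr_gt0.
by rewrite ler_pdivlMr// mulrC ler_wpM2r ?(ltW v0)// ltW.
Qed.

Lemma tree_weight_sum (I : finType) (H G Gq : I -> R) a : 0 < a ->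
  (forall i, 0 <= H i) -> (forall i, 0 <= G i) ->
  \sum_i tree_weight (H i) (G i) (Gq i) a <=
  tree_weight (\sum_i H i) (\sum_i G i) (\sum_i Gq i) a.
Proof.
move=> a0 H0 G0; rewrite /tree_weight big_split/= lerD2r -mulr_sumr ler_wpM2l//.
rewrite mulr_suml; apply: hoelder_sum => //; first by rewrite subrK.
by move=> i; rewrite divr_ge0// mulr_ge0// ltW.
Qed.

Lemma tree_weight_ge H G Gq a : Gq <= tree_weight H G Gq a.
Proof. by rewrite lerDr (mulr_ge0 B_ge0 (mulr_ge0 (powR_ge0 _ _) (powR_ge0 _ _))). Qed.

End tree_weight.

(** * Lipschitz functions on the line *)

Section lipschitz_line.
Context {R : realType}.
Variables (phi : R -> R) (K : R).
Hypothesis K_gt0 : 0 < K.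
Hypothesis phi_lip : forall x y, `|phi x - phi y| <= K * `|x - y|.
Notation leb := (@lebesgue_measure R).

Lemma lipschitz_continuous_line (f : R -> R) C :
  (forall x y, `|f x - f y| <= C * `|x - y|) -> continuous f.
Proof.
move=> fC x; apply/cvgrPdist_le => /= e e0; near=> y.
rewrite (le_trans (fC _ _))//.
apply: (@le_trans _ _ ((`|C| + 1) * `|x - y|)).
  by rewrite ler_wpM2r// (le_trans (ler_norm C))// lerDl.
rewrite -ler_pdivlMl ?ltr_wpDl//; near: y.
apply/nbhs_ballP; exists ((`|C| + 1)^-1 * e) => [|z /ltW//].
by rewrite /= mulr_gt0// invr_gt0 ltr_wpDl.
Unshelve. all: by end_near. Qed.

Lemma lebesgue_stieltjes_ocitv (F : cumulative R R) (a b : R) : a <= b ->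
  lebesgue_stieltjes_measure F `]a, b] = (F b - F a)%:E.
Proof.
move=> ab; rewrite /lebesgue_stieltjes_measure /measure_extension.
rewrite measurable_mu_extE/=; last exact: is_ocitv.
exact: wlength_itv_bnd.
Qed.

Let F x := K * x + phi x.
Let G x := K * x - phi x.

Let F_nd : nondecreasing F.
Proof.
move=> x y xy; have := phi_lip x y; rewrite /F ler_norml => /andP[_].
rewrite -(distrC y) ger0_norm ?subr_ge0//; lra.
Qed.

Let G_nd : nondecreasing G.
Proof.
move=> x y xy; have := phi_lip x y; rewrite /G ler_norml => /andP[+ _].
rewrite -(distrC y) ger0_norm ?subr_ge0//; lra.
Qed.

Let Kcont : continuous (fun x : R => K * x).
Proof. by move=> x; apply: cvgM; [exact: cvg_cst|exact: cvg_id]. Qed.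

Let F_rc : right_continuous F.
Proof.
apply: right_continuousW => x; apply: cvgD; first exact: Kcont.
exact: lipschitz_continuous_line phi_lip _.
Qed.

Let G_rc : right_continuous G.
Proof.
apply: right_continuousW => x; apply: cvgB; first exact: Kcont.
exact: lipschitz_continuous_line phi_lip _.
Qed.

Let cF : cumulative R R := HB.pack F (isCumulative.Build R _ R F F_nd F_rc).
Let cG : cumulative R R := HB.pack G (isCumulative.Build R _ R G G_nd G_rc).

(** The Stieltjes measures of [F = K x + phi] and [G = K x - phi] add up to that
    of [2 K x], a multiple of Lebesgue measure, and so are dominated by it. *)
Let dominated : lebesgue_stieltjes_measure cF `<< leb.
Proof.
apply/null_content_dominatesP => A mA lA0.
have K20 : 0 <= (2 * K)^-1 by rewrite invr_ge0 mulr_ge0// ltW.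
pose m : {measure set (measurableTypeR R) -> \bar R} :=
  mscale (NngNum K20) (measure_add (lebesgue_stieltjes_measure cF)
    (lebesgue_stieltjes_measure cG)).
have mX X : m X = (((2 * K)^-1)%:E * (lebesgue_stieltjes_measure cF X +
    lebesgue_stieltjes_measure cG X))%E by rewrite -measure_addE.
have mE : leb A = m A.
  apply: (lebesgue_measure_unique (mu := m)) => //= _ [[a b] _ <-]/=.
  have [ab|ba] := leP a b; last first.
    by rewrite set_itv_ge ?measure0// bnd_simp -leNgt ltW.
  rewrite mX !lebesgue_stieltjes_ocitv//=.
  rewrite -EFinD -EFinM /lebesgue_measure lebesgue_stieltjes_ocitv//=.
  congr EFin; rewrite /F /G; field; exact: lt0r_neq0.
move: mE; rewrite lA0 mX => /esym/eqP.
rewrite mule_eq0 eqe invr_eq0 mulf_eq0 pnatr_eq0/= gt_eqF//=.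
by rewrite padde_eq0 ?measure_ge0// => /andP[/eqP].
Qed.

(** The density is the Radon-Nikodym derivative of the Stieltjes measure of [F],
    restricted to a bounded interval to be finite. *)
Lemma lipschitz_density (N : R) : 0 < N -> exists g : R -> R,
  leb.-integrable setT (EFin \o g) /\
  forall x, -N <= x <= N ->
    \int[leb]_(t in `]-N, x]) g t = F x - F (-N).
Proof.
move=> N0; have NN : -N <= N by rewrite (@le_trans _ _ 0) ?oppr_le0// ltW.
pose D : set (measurableTypeR R) := `]-N, N]%classic.
have mD : measurable D by exact: measurable_itv.
have Dfin : (lebesgue_stieltjes_measure cF D < +oo)%E.
  by rewrite lebesgue_stieltjes_ocitv// ltry.
pose nu : {finite_measure set (measurableTypeR R) -> \bar R} := mfrestr mD Dfin.
have nul : nu `<< leb.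
  apply/null_content_dominatesP => A mA A0; rewrite /nu/= /mfrestr /mrestr.
  move/null_content_dominatesP : dominated; apply.
    exact: measurableI.
  by apply: (subset_measure0 _ mA _ A0) => //; exact: measurableI.
have [f [f0 ffin intf fE]] := radon_nikodym_sigma_finite nul.
exists (fine \o f); have ff : EFin \o (fine \o f) = f.
  by apply/funext => x /=; rewrite fineK.
rewrite ff; split => // x /andP[Nx xN].
rewrite /Rintegral; under eq_integral do rewrite fineK//.
rewrite -fE; last exact: measurable_itv.
rewrite /nu/= /mfrestr /mrestr setIidl; last by apply: subset_itvl; rewrite bnd_simp.
by rewrite lebesgue_stieltjes_ocitv.
Qed.

(** Lebesgue's differentiation theorem applied to the density [g] of [F]. *)
Let deriv_ae (N : R) : 0 < N -> exists2 g : R -> R,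
  leb.-integrable setT (EFin \o g) /\
    (forall x, -N <= x <= N ->
    \int[leb]_(t in `]-N, x]) g t = F x - F (-N)) &
  {ae leb, forall x, -N < x < N -> derivable phi x 1 /\ 'D_1 phi x = g x - K}.
Proof.
move=> N0; have [g [ig gE]] := lipschitz_density N0; exists g => //.
have igy y : leb.-integrable `]-N, y] (EFin \o g).
  exact: integrableS ig.
have := FTC1 igy (open_integrable_locally openT ig).
apply: (@filterS _ _ (ae_filter_ringOfSetsType leb)).
move=> x /= H /andP[Nx xN]; have {H} := H Nx.
set h := fun _ => _ => -[dh hE].
pose k y := h y + (phi (- N) + K * (- N)) + (- K) * y.
have kd : is_derive x (1:R) k (g x - K).
  have hd : is_derive x (1:R) h (g x).
    by apply: (DeriveDef dh); rewrite -hE derive1E.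
  rewrite /k; apply: is_derive_eq; rewrite /GRing.scale/=; ring.
have nk : {near x, k =1 phi}.
  near=> y; rewrite /k /h gE; first by rewrite /F; ring.
  apply/andP; split; apply: ltW; near: y.
    exact: lt_nbhsr.
  exact: lt_nbhsl.
by have [? <-] := @near_eq_is_derive _ _ _ k phi x 1 _ nk kd.
Unshelve. all: by end_near. Qed.

(** [phi b - phi a] is the integral of [phi'] over the interval, and [d] agrees
    with [phi'] almost everywhere. *)
Lemma lipschitz_le_integral a b (d : R -> R) : a < b ->
  measurable_fun setT d ->
  (forall x, derivable phi x 1 -> d x = 'D_1 phi x) ->
  (`|phi b - phi a|%:E <= \int[leb]_(x in `]a, b[) `|d x|%:E)%E.
Proof.
move=> ab md dE; pose N := `|a| + `|b| + 1.
have na := normr_ge0 a; have nb := normr_ge0 b.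
have N0 : 0 < N by rewrite /N; lra.
have aN : - N < a < N by rewrite -ltr_norml /N; lra.
have bN : - N < b < N by rewrite -ltr_norml /N; lra.
have [g [ig gE] gae] := deriv_ae N0.
have aNw : - N <= a <= N by case/andP: aN => *; rewrite !ltW.
have bNw : - N <= b <= N by case/andP: bN => *; rewrite !ltW.
have iab : leb.-integrable `]a, b] (EFin \o g) by exact: integrableS ig.
have ik : leb.-integrable `]a, b] (EFin \o cst K).
  apply: measurable_bounded_integrable => //.
    by rewrite /= lebesgue_measure_itv/= lte_fin ab -EFinD ltry.
  exact: bounded_cst.
have ig' : leb.-integrable `]a, b] (EFin \o (g \- cst K)).
  by rewrite (_ : _ \o _ = ((EFin \o g) \- (EFin \o cst K))%E)//; exact: integrableB.
have E : phi b - phi a = \int[leb]_(x in `]a, b]) (g x - K).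
  rewrite RintegralB// -(@Rintegral_itvB _ g (BRight (- N)) (BRight b) a).
  - rewrite !gE// Rintegral_cst//= lebesgue_measure_itv/= lte_fin ab/= /F; ring.
  - exact: integrableS ig.
  - by rewrite bnd_simp; case/andP : aNw.
  - by rewrite bnd_simp ltW.
rewrite E EFin_normr_Rintegral//.
apply: le_trans (le_abse_integral _ _ _) _ => //.
  exact: (measurable_int leb).
have mg : measurable_fun setT g by move/measurable_int : ig => /measurable_EFinP.
have mgK : measurable_fun setT (fun x => `|g x - K|%:E).
  by apply/measurable_EFinP; apply: measurableT_comp => //; exact: measurable_funB.
have md' : measurable_fun setT (fun x => `|d x|%:E).
  by apply/measurable_EFinP; apply: measurableT_comp.
rewrite -integral_itv_bndo_bndc; last exact: measurable_funS mgK.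
rewrite le_eqVlt; apply/orP; left; apply/eqP.
apply: ge0_ae_eq_integral => //.
- exact: measurable_funS mgK.
- exact: measurable_funS md'.
move: gae; apply: (@filterS _ _ (ae_filter_ringOfSetsType leb)).
move=> x /= gx; rewrite in_itv/= => /andP[ax xb]; have [|dx E'] := gx.
  by case/andP: aN bN => ? ? /andP[? ?]; apply/andP; split; lra.
by rewrite (dE _ dx) E'.
Qed.

End lipschitz_line.

(** * Boxes and Lebesgue measure *)

Section boxes.
Context {R : realType}.
Notation MR := (measurableTypeR R).
Notation leb := (@lebesgue_measure R).

Definition boxset n (A : 'I_n -> set MR) : set 'rV[R]_n :=
  [set x | forall i, A i (x 0 i)].

Lemma measurable_boxset n (A : 'I_n -> set MR) :
  (forall i, measurable (A i)) -> measurable (boxset A).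
Proof.
move=> mA; rewrite (_ : boxset A = \big[setI/setT]_i ((@rV_coord R n i) @^-1` A i)).
  apply: bigsetI_measurable => i _; rewrite -[X in measurable X]setTI.
  exact: measurable_rV_coord.
apply/seteqP; split=> x; rewrite -bigcap_seq /=.
  by move=> Ax i _; exact: Ax.
by move=> Ax i; apply: Ax; rewrite /= mem_index_enum.
Qed.

Lemma lebesgue_boxset n (A : 'I_n -> set MR) : (forall i, measurable (A i)) ->
  lebesgue_borel n (boxset A) = (\prod_i leb (A i))%E.
Proof.
elim: n A => [|n IH] A mA.
  rewrite big_ord0 /= diracE mem_set//=.
  by case.
rewrite big_ord_recl /=.
rewrite /lebesgue_step /pushforward.
rewrite (_ : _ @^-1` _ = A ord0 `*` boxset (fun i => A (lift ord0 i))).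
  rewrite product_measure1E//; last by apply: measurable_boxset.
  by congr (_ * _)%E; exact: IH.
apply/seteqP; split=> [[x y]|[x y]] /=.
  move=> Ax; have /= K := @rV_consK R n (x, y); split.
    by have := Ax ord0; have [-> _] := K.
  move=> i; have := Ax (lift ord0 i).
  by have /rowP/(_ i) := congr1 snd K; rewrite mxE /= => ->.
move=> [Ax Ay] i; have /= K := @rV_consK R n (x, y).
case: (unliftP ord0 i) => [j ->|->].
  have /rowP/(_ j) := congr1 snd K; rewrite mxE /= => ->; exact: Ay.
by have /= -> := congr1 fst K.
Qed.

(** The boxes are closed under intersection, generate the Borel sets, and the
    bounded ones exhaust the space. *)
Lemma lebesgue_borel_unique n (m : {measure set 'rV[R]_n -> \bar R}) :
  (forall A : 'I_n -> set MR, (forall i, measurable (A i)) ->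
     m (boxset A) = (\prod_i leb (A i))%E) ->
  forall B, measurable B -> lebesgue_borel n B = m B.
Proof.
move=> mE B mB.
pose G := [set boxset A | A in [set A : 'I_n -> set MR | forall i, measurable (A i)]].
pose J (k : nat) : set MR := `]-(k%:R), k%:R]%classic.
have mI k : measurable (J k) by exact: measurable_itv.
pose g (k : nat) : set 'rV[R]_n := boxset (fun _ => J k).
apply: (@measure_unique _ _ _ G g) => //.
- apply/seteqP; split; last first.
    by apply: smallest_sub => [|_ [A mA <-]];
      [exact: sigma_algebra_measurable|exact: measurable_boxset].
  apply: smallest_sub; first exact: smallest_sigma_algebra.
  rewrite -bigcup_seq => C [i _ [D mD <-]] /=; rewrite setTI.
  apply: sub_sigma_algebra; exists (fun j => if j == i then D else setT).
    by move=> j; case: ifP.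
  apply/seteqP; split => x /=.
    by move=> /(_ i); rewrite eqxx.
  by move=> Dx j; case: eqP => [->|].
- move=> _ _ [A mA <-] [A' mA' <-]; exists (fun i => A i `&` A' i).
    by move=> i; exact: measurableI.
  apply/seteqP; split => x /=.
    by move=> AA; split => i; case: (AA i).
  by move=> [h1 h2] i; split; [exact: h1|exact: h2].
- move=> k; exists (fun=> J k) => //.
- apply/seteqP; split => // x _; pose M := \sum_i `|x 0 i|.
  exists (Num.bound M) => // i; rewrite /J /= in_itv/=.
  have xM : `|x 0 i| < (Num.bound M)%:R.
    apply: le_lt_trans (archi_boundP (sumr_ge0 _ (fun i _ => normr_ge0 (x 0 i)))).
    by rewrite (bigD1 i)//= lerDl sumr_ge0.
  by move: xM; rewrite ltr_norml => /andP[-> /ltW ->].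
- by move=> _ [A mA <-]; exact: etrans (lebesgue_boxset mA) (esym (mE A mA)).
- move=> k; apply: (@le_lt_trans _ _ (\prod_(i < n) leb (J k))%E).
    by rewrite le_eqVlt; apply/orP; left; apply/eqP; exact: lebesgue_boxset.
  rewrite -ge0_fin_numE; last by apply: prode_ge0.
  apply: prode_fin_num => i _.
  rewrite /J lebesgue_measure_itv/= lte_fin; case: ifP => // _.
Qed.

End boxes.

(** * Tonelli theorem along a coordinate *)

Section insert_coordinate.
Context {R : realType} {n : nat}.
Notation MR := (measurableTypeR R).
Notation leb := (@lebesgue_measure R).
Notation bor := (@lebesgue_borel R).
Variable i : 'I_n.+1.

Definition insert (z : MR * 'rV[R]_n) : 'rV[R]_n.+1 :=
  \row_j (if unlift i j is Some k then z.2 0 k else z.1).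

Lemma insert_at z : insert z 0 i = z.1.
Proof. by rewrite mxE unlift_none. Qed.

Lemma insert_lift z k : insert z 0 (lift i k) = z.2 0 k.
Proof. by rewrite mxE liftK. Qed.

Lemma measurable_insert : measurable_fun [set: MR * 'rV[R]_n] insert.
Proof.
apply: measurable_fun_rV => j; case: (unliftP i j) => [k ->|->].
  rewrite (_ : _ \o _ = rV_coord k \o snd).
    exact: measurableT_comp (@measurable_rV_coord _ _ k) measurable_snd.
  by apply/funext => x; rewrite /rV_coord /= insert_lift.
rewrite (_ : _ \o _ = fst)//; apply/funext => x.
by rewrite /rV_coord /= insert_at.
Qed.

Lemma insert_boxset (A : 'I_n.+1 -> set MR) :
  insert @^-1` boxset A = A i `*` boxset (fun k => A (lift i k)).
Proof.
apply/seteqP; split => [z Az|z [Ai Az] j] /=.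
  split; first by have := Az i; rewrite insert_at.
  by move=> k; have := Az (lift i k); rewrite insert_lift.
by case: (unliftP i j) => [k ->|->]; rewrite ?insert_lift ?insert_at//; exact: Az.
Qed.

Let push : {measure set 'rV[R]_n.+1 -> \bar R}.
Proof.
refine (pushforward (leb \x bor n)%E insert : {measure set 'rV[R]_n.+1 -> \bar R}).
exact: measurable_insert.
Defined.

(** The measure is built by splitting off the first coordinate; as it is
    determined by its values on boxes, any coordinate may be split off. *)
Lemma lebesgue_borel_insert B : measurable B ->
  bor n.+1 B = pushforward (leb \x bor n)%E insert B.
Proof.
move=> mB; have -> : pushforward (leb \x bor n)%E insert B = push B by [].
apply: lebesgue_borel_unique => // A mA.
rewrite /push/= /pushforward insert_boxset.
rewrite [LHS]product_measure1E//; last by apply: measurable_boxset.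
rewrite (bigD1 i)//=; congr (_ * _)%E.
apply: etrans (lebesgue_boxset (fun k => mA (lift i k))) _.
rewrite [RHS](reindex_omap (lift i) (unlift i)) /=.
  by apply: eq_bigl => k; rewrite eq_sym neq_lift liftK eqxx.
by move=> j; case: unliftP => [k -> //|->]; rewrite eqxx.
Qed.

Lemma tonelli_insert (h : 'rV[R]_n.+1 -> \bar R) :
  measurable_fun setT h -> (forall x, 0 <= h x)%E ->
  (\int[bor n.+1]_x h x = \int[bor n]_y \int[leb]_t h (insert (t, y)))%E.
Proof.
move=> mh h0.
rewrite (@eq_measure_integral _ _ _ _ push); last first.
  by move=> A mA _; exact: lebesgue_borel_insert.
rewrite /push (ge0_integral_pushforward measurable_insert)//.
rewrite (@fubini_tonelli2 _ _ _ _ _ leb (bor n) (h \o insert))//.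
  by apply: measurableT_comp => //; exact: measurable_insert.
by move=> z; exact: h0.
Qed.

Lemma tonelli_boxset (A : 'I_n.+1 -> set MR) (h : 'rV[R]_n.+1 -> \bar R) :
  (forall j, measurable (A j)) ->
  measurable_fun setT h -> (forall x, boxset A x -> 0 <= h x)%E ->
  (\int[bor n.+1]_(x in boxset A) h x =
   \int[bor n]_(y in boxset (fun k => A (lift i k)))
     \int[leb]_(t in A i) h (insert (t, y)))%E.
Proof.
move=> mA mh h0; rewrite integral_mkcond tonelli_insert; last 2 first.
- by apply/(measurable_restrictT _ _).1; [exact: measurable_boxset|
    exact: measurable_funS mh].
- by move=> x; apply: erestrict_ge0.
rewrite [RHS]integral_mkcond; apply: eq_integral => y _.
rewrite patchE; case: ifPn => yA.
  rewrite [RHS]integral_mkcond; apply: eq_integral => t _; rewrite !patchE.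
  congr (if _ then _ else _); apply/idP/idP; rewrite !inE => /= H.
    by have := H i; rewrite insert_at.
  suff : (insert @^-1` boxset A) (t, y) by [].
  by rewrite insert_boxset; split => //=; rewrite inE in yA.
apply: integral0_eq => t _; rewrite patchE ifN//; apply: contra yA.
rewrite !inE => H; have : (insert @^-1` boxset A) (t, y) by [].
by rewrite insert_boxset => -[].
Qed.

Lemma measurable_boxset_section (A : 'I_n.+1 -> set MR) (h : 'rV[R]_n.+1 -> \bar R) :
  measurable (A i) -> measurable_fun setT h ->
  (forall t y, A i t -> 0 <= h (insert (t, y)))%E ->
  measurable_fun setT (fun y => \int[leb]_(t in A i) h (insert (t, y)))%E.
Proof.
move=> mA mh h0; under eq_fun do rewrite integral_mkcond.
pose g (z : MR * 'rV[R]_n) := ((fun t => h (insert (t, z.2))) \_ (A i)) z.1.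
have mg : measurable_fun setT g.
  rewrite (_ : g = (h \o insert) \_ (A i `*` setT)).
    apply/(measurable_restrictT _ _).1; first exact: measurableX.
    apply: (measurable_funS measurableT) => //.
    by apply: measurableT_comp => //; exact: measurable_insert.
  apply/funext => -[t y]; rewrite /g !patchE /=.
  congr (if _ then _ else _); apply/idP/idP; rewrite !inE //=.
  by case.
apply: (@measurable_fun_fubini_tonelli_G _ _ _ _ _ leb g mg).
by move=> -[t y]; rewrite /g/= patchE; case: ifPn => //; rewrite inE => /h0.
Qed.

End insert_coordinate.

(** * Measurability of partial derivatives *)

Section borel_topology.
Context {R : realType} {n : nat}.
Notation MR := (measurableTypeR R).

Lemma ball_boxset (x : 'rV[R]_n) (e : R) : 0 < e ->
  ball x e = boxset (fun i => `]x 0 i - e, x 0 i + e[%classic : set MR).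
Proof.
move=> e0; apply/seteqP; split => y.
  move=> [_ H] i; have := H 0 i; rewrite ball_itv /= => h.
  exact: h.
move=> H; split => // j i; rewrite ord1.
by have := H i; rewrite ball_itv.
Qed.

(** An open set is the union of the boxes with rational centres and radii that
    it contains. *)
Lemma open_measurable_rV (U : set 'rV[R]_n) : open U -> measurable U.
Proof.
move=> oU.
pose F (z : 'rV[rat]_n * rat) : set 'rV[R]_n :=
  let B := boxset (fun i => `]ratr (z.1 0 i) - ratr z.2,
                             ratr (z.1 0 i) + ratr z.2[%classic : set MR) in
  if `[< B `<=` U >] then B else set0.
suff -> : U = \bigcup_z F z.
  apply: countable_bigcupT_measurable; first exact: countableP.
  move=> z; rewrite /F; case: ifP => // _.
  by apply: measurable_boxset => i; exact: measurable_itv.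
apply/seteqP; split => x.
  move=> Ux; have : nbhs x U by exact: open_nbhs_nbhs.
  move=> /nbhs_ballP[e /= e0 xeU].
  have /rat_in_itvoo[r] : 0 < e / 2 by rewrite divr_gt0.
  rewrite in_itv/= => /andP[r0 re].
  have /choice[y yP] : forall i : 'I_n, exists y : rat,
      ratr y \in `]x 0 i - ratr r, x 0 i + ratr r[.
    by move=> i; apply: rat_in_itvoo; rewrite ltrBlDr -addrA ltrDl addr_gt0.
  exists (\row_i y i, r) => //; rewrite /F /=.
  have H : boxset (fun i => `]ratr ((\row_i0 y i0) 0 i) - ratr r,
      ratr ((\row_i0 y i0) 0 i) + ratr r[%classic : set MR) `<=` U.
    move=> z zP; apply: xeU; rewrite ball_boxset// => i.
    have := zP i; rewrite mxE /= !in_itv/= => /andP[z1 z2].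
    have := yP i; rewrite in_itv/= => /andP[y1 y2].
    by apply/andP; split; lra.
  rewrite asboolT// => i; rewrite mxE /= in_itv/=.
  have := yP i; rewrite in_itv/= => /andP[y1 y2].
  by apply/andP; split; lra.
by move=> [z _]; rewrite /F; case: ifPn => // /asboolP; exact.
Qed.

Lemma continuous_measurable_rV (f : 'rV[R]_n -> R) :
  continuous f -> measurable_fun setT f.
Proof.
move=> /continuousP cf; apply: (measurability _ (RGenOpens.measurableE R)).
move=> _ [_ [a [b ->] <-]]; rewrite setTI; apply: open_measurable_rV.
exact/cf/interval_open.
Qed.

Lemma lipschitz_continuous_rV (f : 'rV[R]_n -> R) C :
  (forall x y, `|f x - f y| <= C * `|x - y|) -> continuous f.
Proof.
move=> fC x; apply/(@cvgrPdist_le _ _ _ (nbhs x) (nbhs_filter x)) => e e0.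
apply/nbhs_ballP.
have C0 : 0 < `|C| + 1 by rewrite ltr_wpDl.
exists ((`|C| + 1)^-1 * e) => [|y]; first by rewrite /= mulr_gt0// invr_gt0.
rewrite mx_norm_ball /ball_/= => /ltW xy; apply: (le_trans (fC _ _)).
apply: (@le_trans _ _ ((`|C| + 1) * `|x - y|)).
  by rewrite ler_wpM2r// (le_trans (ler_norm C))// lerDl.
by rewrite -ler_pdivlMl.
Qed.

End borel_topology.

Section partial_derivative.
Context {R : realType} {n : nat}.
Variables (f : 'rV[R]_n -> R) (K : R) (i : 'I_n).
Hypothesis K_gt0 : 0 < K.
Hypothesis f_lip : forall x y, `|f x - f y| <= K * `|x - y|.
Let e : 'rV[R]_n := delta_mx 0 i.

Let q (h : R) (x : 'rV[R]_n) : R := h^-1 * (f (h *: e + x) - f x).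

Let mq h : measurable_fun setT (q h).
Proof.
apply: continuous_measurable_rV.
apply: (@lipschitz_continuous_rV _ _ _ (`|h^-1| * (K * 2))) => x y.
rewrite /q -mulrBr normrM -mulrA ler_wpM2l//.
have -> : f (h *: e + x) - f x - (f (h *: e + y) - f y) =
  (f (h *: e + x) - f (h *: e + y)) - (f x - f y) by ring.
apply: (le_trans (ler_normB _ _)).
have := f_lip (h *: e + x) (h *: e + y); have := f_lip x y.
by rewrite opprD addrACA subrr add0r; lra.
Qed.

Let cq h x : h != 0 -> {for h, continuous (q ^~ x)}.
Proof.
move=> h0; rewrite /q; apply: cvgM; first by apply: cvgV => //; exact: cvg_id.
apply: cvgB; last exact: cvg_cst.
apply: (@lipschitz_continuous_line _ (fun h => f (h *: e + x)) (K * `|e|)) => a b.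
apply: (le_trans (f_lip _ _)); rewrite opprD addrACA subrr addr0 -scalerBl.
by rewrite normrZ mulrAC mulrA.
Qed.

Let derivableE x : derivable f x e = cvg (q ^~ x @ 0^').
Proof. by []. Qed.

Let small (m : nat) (a : R) := (a != 0) && (`|a| < m.+1%:R^-1).

Let S (k m : nat) (a b : rat) : set 'rV[R]_n :=
  if small m (ratr a) && small m (ratr b) then
    [set x | k.+1%:R^-1 < `|q (ratr a) x - q (ratr b) x| ] else set0.

Let mS k m a b : measurable (S k m a b).
Proof.
rewrite /S; case: ifP => // _.
pose g x := `|q (ratr a) x - q (ratr b) x|.
have mg : measurable_fun setT g.
  by apply: measurableT_comp => //; exact: measurable_funB.
rewrite (_ : [set x | _] = setT `&` g @^-1` `]k.+1%:R^-1, +oo[%classic).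
  exact: mg.
by rewrite setTI; apply/seteqP; split => x /=; rewrite in_itv/= andbT.
Qed.

(** The derivative exists when the difference quotients satisfy Cauchy's
    criterion at 0; as the quotients depend continuously on the increment,
    rational increments suffice, which makes the set a countable combination of
    measurable sets. *)
Lemma nonderivable_setE : [set x | ~ derivable f x e] =
  \bigcup_k \bigcap_m \bigcup_a \bigcup_b S k m a b.
Proof.
apply/seteqP; split => x /=; last first.
  move=> [k _ kx]; rewrite derivableE => /cvg_ex[/= l].
  move=> /cvgrPdist_lt /(_ (k.+1%:R^-1 / 2)).
  rewrite divr_gt0 ?invr_gt0// => /(_ isT).
  move=> /nbhs_ballP[d /= d0 H].
  have [m md] : exists m : nat, m.+1%:R^-1 < d.
    exists (Num.bound d^-1); rewrite -[ltRHS]invrK ltf_pV2 ?posrE ?invr_gt0//.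
    apply: lt_trans (archi_boundP (ltW _)) _; rewrite ?invr_gt0//.
    by rewrite ltr_nat.
  have [a _ [b _]] := kx m I; rewrite /S.
  case: ifP => // /andP[/andP[a0 am] /andP[b0 bm]] /=.
  have B c : c != 0 -> `|c| < m.+1%:R^-1 -> `|l - q c x| < k.+1%:R^-1 / 2.
    move=> c0 cm; apply: H => //.
    by rewrite /ball/= sub0r normrN (lt_trans cm).
  have := ler_distD l (q (ratr a) x) (q (ratr b) x).
  have := B _ a0 am; have := B _ b0 bm; rewrite (distrC l (q (ratr a) x)).
  move: (k.+1%:R^-1) => w; lra.
apply: contra_notP => H; rewrite derivableE.
apply/cauchy_cvgP/cauchy_exP => eps eps0.
have [k ke] : exists k : nat, k.+1%:R^-1 < eps.
  exists (Num.bound eps^-1); rewrite -[ltRHS]invrK ltf_pV2 ?posrE ?invr_gt0//.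
  apply: lt_trans (archi_boundP (ltW _)) _; rewrite ?invr_gt0//.
  by rewrite ltr_nat.
have [m Hm] : exists m, forall a b, ~ S k m a b x.
  apply: contra_notP H => H; exists k => // m _.
  apply: contra_notP H => H; exists m => a b.
  by apply: contra_not H => h; exists a => //; exists b.
have m0 : 0 < m.+1%:R^-1 :> R by rewrite invr_gt0.
have [a] := rat_in_itvoo m0; rewrite in_itv/= => /andP[a0 am].
have sa : small m (ratr a) by rewrite /small gt_eqF//= gtr0_norm.
exists (q (ratr a) x); near=> h; rewrite /ball /=.
have h0 : h != 0 by near: h; exact: nbhs_dnbhs_neq.
have hm : `|h| < m.+1%:R^-1 by near: h; exact: dnbhs0_lt.
rewrite ltNge; apply/negP => qh.
pose U := [set b : R | small m b /\ k.+1%:R^-1 < `|q (ratr a) x - q b x| ].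
have : nbhs h U.
  have c1 : {for h, continuous (fun b => `|q (ratr a) x - q b x|)}.
    by apply: cvg_norm; apply: cvgB; [exact: cvg_cst|exact: cq].
  apply: filterI.
    apply: filterS2 (_ : nbhs h [set b | b != 0])
      (_ : nbhs h [set b | `|b| < m.+1%:R^-1]).
    - by move=> b /= b0 bm; rewrite /small b0.
    - by apply: open_nbhs_nbhs; split => //; exact: open_neq.
    - have : {for h, continuous (fun b : R => `|b|)} by exact: norm_continuous.
      by move=> /cvgr_lt; apply.
  move: c1 => /cvgr_gt; apply.
  exact: lt_le_trans ke qh.
move=> /nbhs_ballP[d /= d0 hU].
have /rat_in_itvoo[b] : h - d < h + d by lra.
rewrite in_itv/= => /andP[b1 b2]; have := hU (ratr b).
rewrite /ball/= ltr_distl -ltrBlDr => H'.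
have [|sb qb] := H'.
  by apply/andP; split; lra.
apply: (Hm a b); rewrite /S sa sb /=.
exact: qb.
Unshelve. all: by end_near. Qed.

Lemma measurable_nonderivable : measurable [set x | ~ derivable f x e].
Proof.
rewrite nonderivable_setE; apply: bigcupT_measurable => k.
apply: bigcapT_measurable => m; apply: bigcupT_measurable_rat => a.
exact: bigcupT_measurable_rat.
Qed.

(** With the value 0 where the derivative does not exist this is a measurable
    function, at most ['D_e f] in absolute value at every point. *)
Definition partial_deriv (x : 'rV[R]_n) : R :=
  if `[< derivable f x e >] then 'D_e f x else 0.

Lemma measurable_partial_deriv : measurable_fun setT partial_deriv.
Proof.
have mD : measurable [set x | derivable f x e].
  rewrite -[X in measurable X]setCK; apply: measurableC.
  exact: measurable_nonderivable.
have -> : partial_deriv = (fun x => 'D_e f x) \_ [set x | derivable f x e].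
  apply/funext => x; rewrite patchE /partial_deriv.
  by congr (if _ then _ else _); apply/asboolP/idP; rewrite inE.
apply/(measurable_restrictT _ _).1 => //.
apply: (measurable_fun_cvg (h := fun k => q k.+1%:R^-1)).
  by move=> k; exact: measurable_funS (mq _).
move=> x /= dx.
have qx : q ^~ x @ 0^' --> 'D_e f x by exact: dx.
have H : (k.+1%:R^-1 : R) @[k --> \oo] --> 0^'.
  move=> A /nbhs_ballP[d /= d0 dA].
  have := @cvg_harmonic R; move=> /cvgrPdist_lt /(_ d d0).
  apply: filterS => k; rewrite sub0r normrN /harmonic => kd; apply: dA.
    by rewrite /ball/= sub0r normrN.
  by rewrite /= invr_eq0 pnatr_eq0.
exact: cvg_comp H qx.
Qed.

End partial_derivative.

(** * Integrals over boxes that differ in one coordinate *)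

Section slab.
Context {R : realType}.
Notation MR := (measurableTypeR R).
Notation leb := (@lebesgue_measure R).
Notation bor := (@lebesgue_borel R).

(** On [`]a, b[] the function [phi] varies by at most the integral of [|d|]. Put
    [phi y <= phi x + V] and integrate in [y] over the second interval and in
    [x] over the first. *)
Lemma line_integral_compare (phi d : R -> R) K (a b a1 b1 a2 b2 : R) : 0 < K ->
  (forall x y, `|phi x - phi y| <= K * `|x - y|) ->
  measurable_fun setT d ->
  (forall x, derivable phi x 1 -> d x = 'D_1 phi x) ->
  (forall x, 0 <= phi x) ->
  a <= a1 -> a1 < b1 -> b1 <= b -> a <= a2 -> a2 < b2 -> b2 <= b ->
  ((b1 - a1)%:E * \int[leb]_(x in `]a2, b2[) (phi x)%:E <=
   (b2 - a2)%:E * \int[leb]_(x in `]a1, b1[) (phi x)%:E +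
   ((b1 - a1) * (b2 - a2))%:E * \int[leb]_(x in `]a, b[) `|d x|%:E)%E.
Proof.
move=> K0 lip md dE phi0 aa1 ab1 b1b aa2 ab2 b2b.
set V := (\int[leb]_(x in `]a, b[) _)%E.
have mphi : measurable_fun setT (EFin \o phi).
  apply/measurable_EFinP; apply: continuous_measurable_fun.
  exact: lipschitz_continuous_line lip.
have V0 : (0 <= V)%E by apply: integral_ge0 => x _; rewrite lee_fin.
have H x y : a < x -> y < b -> x <= y -> (`|phi y - phi x|%:E <= V)%E.
  move=> ax yb; rewrite le_eqVlt => /predU1P[->|xy].
    by rewrite subrr normr0.
  apply: le_trans (lipschitz_le_integral K0 lip xy md dE) _.
  apply: ge0_subset_integral => //=.
  - apply: (measurable_funS measurableT) => //.
    by apply/measurable_EFinP; apply: measurableT_comp.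
  - by apply: subset_itv; rewrite bnd_simp ltW.
have osc x y : a < x < b -> a < y < b -> ((phi y)%:E <= (phi x)%:E + V)%E.
  move=> /andP[ax xb] /andP[ay yb].
  apply: (@le_trans _ _ ((phi x)%:E + `|phi y - phi x|%:E)%E).
    by rewrite -EFinD lee_fin -lerBlDl ler_norm.
  rewrite leeD2l//; have [xy|/ltW yx] := leP x y; first exact: H.
  by rewrite distrC; exact: H.
have len (c e : R) : c < e -> leb `]c, e[%classic = (e - c)%:E.
  by move=> ce; rewrite lebesgue_measure_itv/= lte_fin ce -EFinD.
have step x : a1 < x < b1 ->
    (\int[leb]_(y in `]a2, b2[) (phi y)%:E <= ((phi x)%:E + V) * (b2 - a2)%:E)%E.
  move=> /andP[x1 x2]; rewrite -len// -integral_cst//.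
  apply: ge0_le_integral => //.
  - by move=> y _; rewrite lee_fin.
  - exact: measurable_funS mphi.
  - move=> y /=; rewrite in_itv/= => /andP[y1 y2].
    by apply: osc; apply/andP; split; lra.
rewrite -len// muleC -integral_cst//.
apply: (@le_trans _ _ (\int[leb]_(x in `]a1, b1[) (((phi x)%:E + V) * (b2 - a2)%:E))%E).
  apply: ge0_le_integral => //.
  - by move=> x _; apply: integral_ge0 => y _; rewrite lee_fin.
  - apply: emeasurable_funM => //; apply: emeasurable_funD => //.
    exact: measurable_funS mphi.
have mphi1 : measurable_fun `]a1, b1[ (EFin \o phi) by exact: measurable_funS mphi.
rewrite ge0_integralZr//; last 3 first.
- by apply: emeasurable_funD.
- by move=> x _; rewrite adde_ge0// lee_fin.
- by rewrite lee_fin subr_ge0 ltW.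
rewrite ge0_integralD//; last by move=> x _; rewrite lee_fin.
rewrite integral_cst//= len// ge0_muleDl; last 2 first.
- by apply: integral_ge0 => x _; rewrite lee_fin.
- by rewrite mule_ge0// lee_fin subr_ge0 ltW.
by rewrite muleC leeD2l// -muleA -EFinM muleC.
Qed.

Variable n : nat.
Variables (f : 'rV[R]_n.+1 -> R) (K : R).
Hypothesis K_gt0 : 0 < K.
Hypothesis f_lip : forall x y, `|f x - f y| <= K * `|x - y|.
Variable i : 'I_n.+1.
Let e : 'rV[R]_n.+1 := delta_mx 0 i.
Let line (y : 'rV[R]_n) (t : R) := f (insert i (t, y)).

Lemma insertD (h t : R) y :
  insert i (h + t, y) = h *: e + insert i (t, y) :> 'rV[R]_n.+1.
Proof.
apply/rowP => j; rewrite [RHS]mxE [(h *: e) 0 j]mxE [e 0 j]mxE eqxx /=.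
case: (unliftP i j) => [k ->|->].
  by rewrite !insert_lift eq_sym (negbTE (neq_lift _ _)) mulr0 add0r.
by rewrite !insert_at eqxx mulr1.
Qed.

Let line_lip y a b : `|line y a - line y b| <= (K * (`|e| + 1)) * `|a - b|.
Proof.
apply: (le_trans (f_lip _ _)).
rewrite -(subrK b a) insertD addrK -mulrA ler_wpM2l ?(ltW K_gt0)//.
by rewrite addrK normrZ mulrC ler_wpM2r// lerDl.
Qed.

Let Ke_gt0 : 0 < K * (`|e| + 1).
Proof. by rewrite mulr_gt0// ltr_wpDl. Qed.

Let lineE y t : (fun h : R => h^-1 *: ((line y \o shift t) (h *: (1 : R)) - line y t)) =
  (fun h : R => h^-1 *:
    ((f \o shift (insert i (t, y))) (h *: e) - f (insert i (t, y)))).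
Proof.
apply/funext => h; rewrite /line /= -insertD /GRing.scale/= mulr1.
by [].
Qed.

Lemma derivable_line y t : derivable (line y) t 1 = derivable f (insert i (t, y)) e.
Proof. by rewrite /derivable lineE. Qed.

Lemma derive_line y t : 'D_1 (line y) t = 'D_e f (insert i (t, y)).
Proof. by rewrite /derive lineE. Qed.

Definition box_update (A : 'I_n.+1 -> set MR) (X : set MR) :=
  boxset (fun j => if j == i then X else A j).

Lemma tonelli_box_update A X (h : 'rV[R]_n.+1 -> \bar R) :
  (forall j, measurable (A j)) -> measurable X -> measurable_fun setT h ->
  (forall x, 0 <= h x)%E ->
  (\int[bor n.+1]_(x in box_update A X) h x =
  \int[bor n]_(y in boxset (fun k => A (lift i k)))
    \int[leb]_(t in X) h (insert i (t, y)))%E.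
Proof.
move=> mA mX mh h0; have mU j : measurable (if j == i then X else A j) by case: ifP.
rewrite /box_update (tonelli_boxset i mU mh (fun x _ => h0 x)) eqxx.
congr (integral _ _ _); congr boxset.
by apply/funext => k; rewrite eq_sym (negbTE (neq_lift _ _)).
Qed.

Hypothesis f_ge0 : forall x, 0 <= f x.

(** Integrate [line_integral_compare] over the remaining coordinates. *)
Lemma slab_integral_compare A (a b a1 b1 a2 b2 : R) :
  (forall j, measurable (A j)) ->
  a <= a1 -> a1 < b1 -> b1 <= b -> a <= a2 -> a2 < b2 -> b2 <= b ->
  ((b1 - a1)%:E * \int[bor n.+1]_(x in box_update A `]a2, b2[%classic) (f x)%:E <=
   (b2 - a2)%:E * \int[bor n.+1]_(x in box_update A `]a1, b1[%classic) (f x)%:E +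
   ((b1 - a1) * (b2 - a2))%:E *
     \int[bor n.+1]_(x in box_update A `]a, b[%classic) `|partial_deriv f i x|%:E)%E.
Proof.
move=> mA aa1 ab1 b1b aa2 ab2 b2b.
have mf : measurable_fun setT (EFin \o f).
  apply/measurable_EFinP; apply: continuous_measurable_rV.
  exact: lipschitz_continuous_rV f_lip.
have mp := @measurable_partial_deriv _ _ f K i f_lip.
have mp' : measurable_fun setT (fun x => `|partial_deriv f i x|%:E).
  by apply/measurable_EFinP; apply: measurableT_comp.
have f0 x : (0 <= (EFin \o f) x)%E by rewrite lee_fin.
have p0 x : (0 <= `|partial_deriv f i x|%:E)%E by rewrite lee_fin.
rewrite !tonelli_box_update//.
set B := boxset _; have mB : measurable B by exact: measurable_boxset.
have sec (u v : R) (h : 'rV[R]_n.+1 -> \bar R) : measurable_fun setT h ->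
    (forall x, 0 <= h x)%E ->
    measurable_fun B (fun y => \int[leb]_(t in `]u, v[) h (insert i (t, y)))%E.
  move=> mh h0; apply: (measurable_funS measurableT) => //.
  by apply: (@measurable_boxset_section _ _ i (fun=> `]u, v[%classic)).
have int0 (u v : R) (h : 'rV[R]_n.+1 -> \bar R) (y : 'rV[R]_n) :
    (forall x, 0 <= h x)%E ->
    (0 <= \int[leb]_(t in `]u, v[) h (insert i (t, y)))%E.
  by move=> h0; apply: integral_ge0 => t _; exact: h0.
have l1 : (0 <= (b1 - a1)%:E)%E by rewrite lee_fin subr_ge0 ltW.
have l2 : (0 <= (b2 - a2)%:E)%E by rewrite lee_fin subr_ge0 ltW.
have l12 : (0 <= ((b1 - a1) * (b2 - a2))%:E)%E by rewrite EFinM mule_ge0.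
pose I2 (y : 'rV[R]_n) := (\int[leb]_(t in `]a2, b2[) (EFin \o f) (insert i (t, y)))%E.
pose I1 (y : 'rV[R]_n) := (\int[leb]_(t in `]a1, b1[) (EFin \o f) (insert i (t, y)))%E.
pose IV (y : 'rV[R]_n) :=
  (\int[leb]_(t in `]a, b[) `|partial_deriv f i (insert i (t, y))|%:E)%E.
have mI2 : measurable_fun B I2 by exact: sec.
have mI1 : measurable_fun B I1 by exact: sec.
have mIV : measurable_fun B IV by exact: (sec a b _ mp').
have I20 y : (0 <= I2 y)%E by exact: int0.
have I10 y : (0 <= I1 y)%E by exact: int0.
have IV0 y : (0 <= IV y)%E by exact: (int0 a b _ y p0).
have Z2 : (\int[bor n]_(y in B) ((b1 - a1)%:E * I2 y) =
    (b1 - a1)%:E * \int[bor n]_(y in B) I2 y)%E.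
  by apply: ge0_integralZl.
have Z1 : (\int[bor n]_(y in B) ((b2 - a2)%:E * I1 y) =
    (b2 - a2)%:E * \int[bor n]_(y in B) I1 y)%E.
  by apply: ge0_integralZl.
have ZV : (\int[bor n]_(y in B) (((b1 - a1) * (b2 - a2))%:E * IV y) =
    ((b1 - a1) * (b2 - a2))%:E * \int[bor n]_(y in B) IV y)%E.
  by apply: ge0_integralZl.
have mZ (c : R) (g : 'rV[R]_n -> \bar R) : measurable_fun B g ->
    measurable_fun B (fun y => c%:E * g y)%E.
  by move=> mg; apply: emeasurable_funM.
have P (c : R) (g : 'rV[R]_n -> \bar R) y : (0 <= c%:E)%E -> (0 <= g y)%E ->
    (0 <= c%:E * g y)%E by move=> *; exact: mule_ge0.
rewrite -[X in (X <= _)%E]Z2 -[X in (_ <= X + _)%E]Z1 -[X in (_ <= _ + X)%E]ZV.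
have -> : (\int[bor n]_(y in B) ((b2 - a2)%:E * I1 y) +
    \int[bor n]_(y in B) (((b1 - a1) * (b2 - a2))%:E * IV y) =
  \int[bor n]_(y in B) ((b2 - a2)%:E * I1 y + ((b1 - a1) * (b2 - a2))%:E * IV y))%E.
  apply/esym/ge0_integralD => //; by [move=> y _; exact: P|exact: mZ].
apply: ge0_le_integral => //.
- by move=> y _; exact: P.
- exact: mZ.
- by apply: emeasurable_funD; exact: mZ.
move=> y _; apply: (@line_integral_compare (line y)
    (fun t => partial_deriv f i (insert i (t, y))) _ _ _ _ _ _ _
    Ke_gt0 (line_lip y)) => //.
- have H := measurableT_comp (measurable_insert i)
    (@pair2_measurable _ _ MR 'rV[R]_n y).
  exact: measurableT_comp mp H.
- move=> t; rewrite derivable_line derive_line => dt.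
  by rewrite /partial_deriv asboolT.
- by move=> t; exact: f_ge0.
Qed.

End slab.

(** * Completed Lebesgue measure and dyadic cells *)

Section completed.
Context {R : realType} {n : nat}.
Notation bor := (@lebesgue_borel R n).
Notation mu := (@lebesgue_rV R n).

(** The space of row vectors with the Lebesgue measurable sets, on which the
    completed measure lives; the row vectors themselves carry the Borel sets. *)
Definition lebesgue_space := caratheodory_type (mu_ext bor).
Notation CT := lebesgue_space.

Lemma measurable_completed (B : set 'rV[R]_n) :
  measurable B -> measurable (B : set CT).
Proof. by move=> mB; apply: sub_caratheodory; exact: sub_sigma_algebra. Qed.

Lemma lebesgue_rVE (B : set 'rV[R]_n) : measurable B -> mu B = bor B.
Proof. by move=> mB; exact: measurable_mu_extE. Qed.

Lemma measurable_fun_completed d (T : measurableType d) (D : set 'rV[R]_n)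
    (f : 'rV[R]_n -> T) : measurable D ->
  measurable_fun D f -> measurable_fun (D : set CT) (f : CT -> T).
Proof.
by move=> mD mf _ Y mY; apply: measurable_completed; exact: mf.
Qed.

Lemma integral_completed (D : set 'rV[R]_n) (f : 'rV[R]_n -> \bar R) :
  measurable D -> measurable_fun D f -> (forall x, D x -> 0 <= f x)%E ->
  (\int[mu]_(x in D) f x = \int[bor]_(x in D) f x)%E.
Proof.
move=> mD mf f0.
have mid : measurable_fun [set: CT] (idfun : CT -> 'rV[R]_n).
  by move=> _ B mB; rewrite setTI; exact: measurable_completed.
transitivity (\int[pushforward mu (idfun : CT -> 'rV[R]_n)]_(x in D) f x)%E.
  rewrite (ge0_integral_pushforward mid)//.
  by move=> x; rewrite inE; exact: f0.
apply: eq_measure_integral => B mB _.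
exact: lebesgue_rVE.
Qed.

Lemma completed_null (N B : set 'rV[R]_n) : measurable B -> bor B = 0%E ->
  N `<=` B -> measurable (N : set CT) /\ mu N = 0%E.
Proof.
move=> mB B0 NB.
have mB' := measurable_completed mB.
have muB : mu B = 0%E by rewrite lebesgue_rVE.
have mN : measurable (N : set CT).
  by apply: (@measure_is_complete_caratheodory _ _ (mu_ext bor)); exists B.
by split => //; exact: (subset_measure0 mN mB' NB muB).
Qed.

End completed.

Section dyadic_cells.
Context {R : realType} {n : nat}.
Notation MR := (measurableTypeR R).
Notation leb := (@lebesgue_measure R).
Notation bor := (@lebesgue_borel R n).
Notation mu := (@lebesgue_rV R n).
Notation CT := (@lebesgue_space R n).
Notation cell := ('rV[R]_n * R)%type.
Notation pos := {ffun 'I_n -> bool}.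
Implicit Types (c : cell) (e : pos).

(** A cube is handled through its corner and side, from which
    its children can be written down. *)
Definition cell_set c : set 'rV[R]_n := cube c.1 c.2.

Definition cell_child c e : cell :=
  (\row_i (c.1 0 i + (e i)%:R * (c.2 / 2)), c.2 / 2).

Lemma cell_setE c :
  cell_set c = boxset (fun i => `]c.1 0 i, c.1 0 i + c.2[%classic : set MR).
Proof. by apply/seteqP; split => x H i; have := H i; rewrite /= in_itv. Qed.

Lemma measurable_cell c : measurable (cell_set c).
Proof.
by rewrite cell_setE; apply: measurable_boxset => i; exact: measurable_itv.
Qed.

Lemma open_cell c : open (cell_set c).
Proof.
rewrite openE => x Hx.
apply: (@filter_forall _ _ _ _ (nbhs_filter x)) => i.
have : nbhs (x 0 i) `]c.1 0 i, c.1 0 i + c.2[%classic.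
  apply: open_nbhs_nbhs; split; first exact: interval_open.
  by rewrite /= in_itv/=; exact: Hx.
move=> /(@coord_continuous _ _ _ 0 i x); apply: (@filterS _ _ (nbhs_filter x)) => y.
by rewrite /= in_itv.
Qed.

Lemma lebesgue_cell c : 0 < c.2 -> mu (cell_set c) = (c.2 ^+ n)%:E.
Proof.
move=> l0; rewrite lebesgue_rVE; last exact: measurable_cell.
rewrite cell_setE lebesgue_boxset; last by move=> i; exact: measurable_itv.
under eq_bigr => i _.
  rewrite lebesgue_measure_itv/= lte_fin ltrDl l0 -EFinD addrAC subrr add0r.
  over.
by rewrite prodEFin prodr_const card_ord.
Qed.

Lemma cell_child_sub c e : 0 < c.2 -> cell_set (cell_child c e) `<=` cell_set c.
Proof.
move=> l0 x H i; have := H i; rewrite /= mxE => /andP[h1 h2].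
by move: h1 h2; case: (e i); rewrite ?mul1r ?mul0r => h1 h2; apply/andP; split; lra.
Qed.

Lemma cell_child_disj c e e' x : 0 < c.2 ->
  cell_set (cell_child c e) x -> cell_set (cell_child c e') x -> e = e'.
Proof.
move=> l0 H H'; apply/ffunP => i; have := H i; have := H' i; rewrite /= !mxE.
by case: (e i); case: (e' i) => //; rewrite ?mul1r ?mul0r => /andP[? ?] /andP[? ?]; lra.
Qed.

Definition hyperplane (i : 'I_n) (b : R) : set 'rV[R]_n := [set x | x 0 i = b].

Let hyperplaneE i b : hyperplane i b =
  boxset (fun j => if j == i then [set b] else setT : set MR).
Proof.
apply/seteqP; split => x /=; first by move=> xb j; case: eqP => [->|].
by move=> /(_ i); rewrite eqxx.
Qed.

Lemma measurable_hyperplane i b : measurable (hyperplane i b).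
Proof.
by rewrite hyperplaneE; apply: measurable_boxset => j; case: ifP.
Qed.

Lemma hyperplane_null i b : bor (hyperplane i b) = 0%E.
Proof.
rewrite hyperplaneE lebesgue_boxset.
  by rewrite (bigD1 i)//= eqxx lebesgue_measure_set1 mul0e.
by move=> j; case: ifP.
Qed.

Lemma cell_cover c x : 0 < c.2 -> cell_set c x ->
  (forall i, x 0 i != c.1 0 i + c.2 / 2) -> exists e, cell_set (cell_child c e) x.
Proof.
move=> l0 H xn; exists [ffun i => c.1 0 i + c.2 / 2 < x 0 i] => i.
have := H i; have := xn i; rewrite /= mxE ffunE => xi /andP[h1 h2].
have [lt|ge] := ltP (c.1 0 i + c.2 / 2) (x 0 i).
  by rewrite mul1r; apply/andP; split; lra.
have {}ge : x 0 i < c.1 0 i + c.2 / 2 by rewrite lt_neqAle xi.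
by rewrite mul0r; apply/andP; split; lra.
Qed.

(** The open children miss only points of the hyperplanes that bisect the cell,
    a null set. *)
Lemma integral_cell_child c (h : 'rV[R]_n -> \bar R) : 0 < c.2 ->
  measurable_fun (cell_set c : set CT) (h : CT -> \bar R) ->
  (forall x, cell_set c x -> 0 <= h x)%E ->
  (\int[mu]_(x in cell_set c) h x =
   \sum_e \int[mu]_(x in cell_set (cell_child c e)) h x)%E.
Proof.
move=> l0 mh h0.
pose U := \big[setU/set0]_(e <- enum pos) cell_set (cell_child c e).
have mU : measurable U by apply: bigsetU_measurable => e _; exact: measurable_cell.
have UE : U = [set x | exists e, cell_set (cell_child c e) x].
  rewrite /U -bigcup_seq; apply/seteqP; split => x /=.
    by move=> [e _ ex]; exists e.
  by move=> [e ex]; exists e => //=; rewrite mem_enum.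
have Uc : U `<=` cell_set c by rewrite UE => x [e]; exact: cell_child_sub.
pose N := cell_set c `\` U.
have mN : measurable N by apply: measurableD => //; exact: measurable_cell.
pose Z := \big[setU/set0]_(i <- enum 'I_n) hyperplane i (c.1 0 i + c.2 / 2).
have mZ : measurable Z.
  by apply: bigsetU_measurable => i _; exact: measurable_hyperplane.
have Z0 : bor Z = 0%E.
  apply/(negligibleP _ mZ); rewrite /Z.
  elim/big_ind : _ => [|A B|i _].
  - exact: negligible_set0.
  - exact: negligibleU.
  - by apply/(negligibleP _ (measurable_hyperplane _ _)); exact: hyperplane_null.
have muN : mu N = 0%E.
  apply: (proj2 (completed_null mZ Z0 _)) => x [cx Ux].
  apply: contrapT => Zx; apply: Ux; rewrite UE; apply: cell_cover => // i.
  apply/eqP => xi; apply: Zx; rewrite /Z -bigcup_seq; exists i => //=.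
  by rewrite mem_enum.
rewrite (@ge0_negligible_integral _ CT _ mu _ N)//; last 2 first.
- exact: measurable_completed.
- exact: (measurable_completed (measurable_cell _)).
have -> : cell_set c `\` N = U.
  by rewrite /N setDD; apply/seteqP; split => [x []//|x Ux]; split => //; exact: Uc.
rewrite /U ge0_integral_bigsetU//.
- by rewrite big_enum.
- by move=> e; exact: (measurable_completed (measurable_cell _)).
- exact: enum_uniq.
- apply/trivIsetP => e e' _ _ ee'; apply/seteqP; split => // x [ex e'x].
  by move: ee'; rewrite (cell_child_disj l0 ex e'x) eqxx.
- by apply: measurable_funS mh => //; exact: (measurable_completed (measurable_cell _)).
- by move=> x /Uc; exact: h0.
Qed.

End dyadic_cells.

(** * Averages over a cell and over its children *)

Section child_average.
Context {R : realType} {n : nat}.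
Notation MR := (measurableTypeR R).
Notation bor := (@lebesgue_borel R n.+1).
Variables (f : 'rV[R]_n.+1 -> R) (K : R) (h : 'rV[R]_n.+1 -> \bar R).
Hypothesis K_gt0 : 0 < K.
Hypothesis f_lip : forall x y, `|f x - f y| <= K * `|x - y|.
Hypothesis f_ge0 : forall x, 0 <= f x.
Hypothesis mh : measurable_fun setT h.
Hypothesis partial_le : forall i x, (`|partial_deriv f i x|%:E <= h x)%E.
Variables (c : 'rV[R]_n.+1 * R) (e : {ffun 'I_n.+1 -> bool}).
Hypothesis c_gt0 : 0 < c.2.
Let c' := cell_child c e.
Let l := c.2.
Hypothesis f_fin : (\int[bor]_(x in cell_set c) (f x)%:E < +oo)%E.
Hypothesis h_fin : (\int[bor]_(x in cell_set c) h x < +oo)%E.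

Let A0 (i : 'I_n.+1) : set MR := `]c.1 0 i, c.1 0 i + l[%classic.
Let A1 (i : 'I_n.+1) : set MR := `]c'.1 0 i, c'.1 0 i + l / 2[%classic.
(** The boxes that lead from the cell to its child, shrunk in the first [k]
    coordinates. *)
Let mid (k : nat) (j : 'I_n.+1) : set MR := if (j < k)%N then A1 j else A0 j.

Let mid_meas k j : measurable (mid k j).
Proof. by rewrite /mid; case: ifP => _; exact: measurable_itv. Qed.

Let c'E i : c'.1 0 i = c.1 0 i \/ c'.1 0 i = c.1 0 i + l / 2.
Proof.
by rewrite /c' /= mxE; case: (e i); rewrite ?mul1r ?mul0r ?addr0; [right|left].
Qed.

Let A10 i : A1 i `<=` A0 i.
Proof.
move=> x; rewrite /A1 /A0 /= !in_itv/= => /andP[h1 h2]; have l0 : 0 < l by [].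
by apply/andP; case: (c'E i) h1 h2 => -> h1 h2; split; lra.
Qed.

Let mid0 : boxset (mid 0) = cell_set c.
Proof. by rewrite cell_setE. Qed.

Let midn : boxset (mid n.+1) = cell_set c'.
Proof.
rewrite cell_setE; congr boxset; apply/funext => j; rewrite /mid ltn_ord.
by [].
Qed.

Let mid_sub k : boxset (mid k) `<=` cell_set c.
Proof.
rewrite -mid0 => x H i; have := H i; rewrite /mid ltn0; case: ifP => // _.
exact: A10.
Qed.

Let midA0 (i : 'I_n.+1) : boxset (mid i) = box_update i (mid i) (A0 i).
Proof.
congr boxset; apply/funext => j; case: eqP => // ->.
by rewrite /mid ltnn.
Qed.

Let midA1 (i : 'I_n.+1) : boxset (mid i.+1) = box_update i (mid i) (A1 i).
Proof.
congr boxset; apply/funext => j; rewrite /mid ltnS; case: eqP => [->|/eqP ji].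
  by rewrite leqnn.
by rewrite leq_eqVlt (negbTE (_ : (j : nat) != i))//.
Qed.

Let F k := (\int[bor]_(x in boxset (mid k)) (f x)%:E)%E.
Let H := (\int[bor]_(x in cell_set c) h x)%E.

Let mf : measurable_fun setT (EFin \o f).
Proof.
apply/measurable_EFinP; apply: continuous_measurable_rV.
exact: lipschitz_continuous_rV f_lip.
Qed.

Let h_ge0 x : (0 <= h x)%E.
Proof. by apply: le_trans (partial_le ord0 x); rewrite lee_fin. Qed.

Let G_le i k : (\int[bor]_(x in boxset (mid k)) `|partial_deriv f i x|%:E <= H)%E.
Proof.
have mbox : measurable (boxset (mid k)) by exact: measurable_boxset.
apply: (@le_trans _ _ (\int[bor]_(x in boxset (mid k)) h x)%E).
  apply: ge0_le_integral => //.
  - apply: (measurable_funS measurableT) => //.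
    apply/measurable_EFinP; apply: measurableT_comp => //.
    exact: measurable_partial_deriv f_lip.
  - exact: measurable_funS mh.
apply: ge0_subset_integral => //.
- exact: measurable_cell.
- exact: measurable_funS mh.
Qed.

Let F_ge0 k : (0 <= F k)%E.
Proof. by apply: integral_ge0 => x _; rewrite lee_fin. Qed.

Let F_fin k : F k \is a fin_num.
Proof.
rewrite ge0_fin_numE//; apply: le_lt_trans f_fin.
apply: ge0_subset_integral => //.
- exact: measurable_boxset.
- exact: measurable_cell.
- exact: measurable_funS mf.
- by move=> x _; rewrite lee_fin.
Qed.

Let H_fin : H \is a fin_num.
Proof. by rewrite ge0_fin_numE//; apply: integral_ge0 => x _; exact: h_ge0. Qed.

(** Halving the box in direction [i] halves the integral of [f], up to the
    integral of the partial derivative: [slab_integral_compare] is applied with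
    the long and the half interval in both orders. *)
Let step (i : 'I_n.+1) : `|2 * fine (F i.+1) - fine (F i)| <= l * fine H.
Proof.
have l0 : 0 < l by [].
have b1 : c.1 0 i <= c'.1 0 i by case: (c'E i) => ->; lra.
have b2 : c'.1 0 i + l / 2 <= c.1 0 i + l by case: (c'E i) => ->; lra.
have b3 : c'.1 0 i < c'.1 0 i + l / 2 by lra.
have b4 : c.1 0 i < c.1 0 i + l by lra.
have GH := G_le i i.
have S1 := slab_integral_compare K_gt0 f_lip i f_ge0 (mid_meas i)
  (lexx _) b4 (lexx _) b1 b3 b2.
have S2 := slab_integral_compare K_gt0 f_lip i f_ge0 (mid_meas i)
  b1 b3 b2 (lexx _) b4 (lexx _).
move: S1 S2; rewrite -/(A0 i) -/(A1 i) -midA0 -midA1 -/(F i) -/(F i.+1).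
have -> : c.1 0 i + l - c.1 0 i = l by ring.
have -> : c'.1 0 i + l / 2 - c'.1 0 i = l / 2 by ring.
have G0 : (0 <= \int[bor]_(x in boxset (mid i)) `|partial_deriv f i x|%:E)%E.
  by apply: integral_ge0 => x _; rewrite lee_fin.
have Gfin : (\int[bor]_(x in boxset (mid i)) `|partial_deriv f i x|%:E)%E \is a fin_num.
  by rewrite ge0_fin_numE// (le_lt_trans GH).
move: GH; rewrite -(fineK Gfin) -(fineK H_fin) -(fineK (F_fin i)) -(fineK (F_fin i.+1)).
rewrite -!EFinM -!EFinD !lee_fin /=.
set g := fine _; set y := fine (F i); set z := fine (F i.+1) => gH S1 S2.
rewrite ler_norml; apply/andP; split.
  have : l / 2 * y <= l / 2 * (2 * z + l * g) by lra.
  rewrite ler_pM2l ?divr_gt0// => yz.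
  have := ler_wpM2l (ltW l0) gH; lra.
have : l / 2 * (2 * z) <= l / 2 * (y + l * g) by lra.
rewrite ler_pM2l ?divr_gt0// => yz.
have := ler_wpM2l (ltW l0) gH; lra.
Qed.

(** The [k]-th halving, counted from 0, contributes its error times [2^k], and
    [1 + 2 + ... + 2^n < 2^(n + 1)]. *)
Lemma child_average_le :
  `|fine (\int[bor]_(x in cell_set c') (f x)%:E)%E / c'.2 ^+ n.+1 -
    fine (\int[bor]_(x in cell_set c) (f x)%:E)%E / c.2 ^+ n.+1| <=
  2 ^+ n.+1 * c.2 * (fine H / c.2 ^+ n.+1).
Proof.
have l0 : 0 < l by [].
have H0 : 0 <= fine H.
  by rewrite fine_ge0//; apply: integral_ge0 => x _; exact: h_ge0.
have ind k : (k <= n.+1)%N ->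
    `|2 ^+ k * fine (F k) - fine (F 0)| <= (2 ^+ k - 1) * (l * fine H).
  elim: k => [|k IH kn]; first by rewrite expr0 mul1r !subrr mul0r normr0.
  have := IH (ltnW kn); have := step (Ordinal kn) => /= s1 s2.
  have -> : 2 ^+ k.+1 * fine (F k.+1) - fine (F 0) =
    2 ^+ k * (2 * fine (F k.+1) - fine (F k)) + (2 ^+ k * fine (F k) - fine (F 0)).
    by rewrite exprS; ring.
  apply: le_trans (ler_normD _ _) _.
  have k0 : 0 <= 2 ^+ k :> R by rewrite exprn_ge0.
  rewrite normrM (ger0_norm k0).
  have := ler_wpM2l k0 s1; rewrite exprS; lra.
have := ind _ (leqnn n.+1).
rewrite /F mid0 midn => HH.
set X1 := fine _ in HH *; set X0 := fine _ in HH *.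
have v0 : 0 < c.2 ^+ n.+1 by rewrite exprn_gt0.
have p0 : 2 ^+ n.+1 != 0 :> R by rewrite expf_neq0.
have -> : X1 / c'.2 ^+ n.+1 - X0 / c.2 ^+ n.+1 = (2 ^+ n.+1 * X1 - X0) / c.2 ^+ n.+1.
  rewrite /c' /= expr_div_n; field.
  by rewrite p0 gt_eqF.
rewrite normrM normfV (gtr0_norm v0) mulrA ler_wpM2r ?invr_ge0 ?(ltW v0)//.
apply: (le_trans HH); rewrite -/l mulrBl mul1r -mulrA.
by rewrite lerBlDr lerDl mulr_ge0// ltW.
Qed.

End child_average.

(** * The norm of the gradient *)

Section gradient_norm.
Context {R : realType} {n : nat}.
Notation bor := (@lebesgue_borel R n).
Variables (f : 'rV[R]_n -> R) (K : R).
Hypothesis f_lip : forall x y, `|f x - f y| <= K * `|x - y|.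

Lemma partial_deriv_bound i x :
  `|partial_deriv f i x| <= K * `|delta_mx 0 i : 'rV[R]_n|.
Proof.
set e : 'rV[R]_n := delta_mx 0 i.
have Ke0 : 0 <= K * `|e|.
  by have := le_trans (normr_ge0 _) (f_lip e 0); rewrite subr0.
rewrite /partial_deriv; case: asboolP => [dx|_]; last by rewrite normr0.
pose q (h : R) := h^-1 *: ((f \o shift x) (h *: e) - f x).
have qx : `|q h| @[h --> 0^'] --> `|'D_e f x|.
  by apply: cvg_norm; exact: dx.
apply: (cvgr_to_le qx).
near=> h; have h0 : h != 0 by near: h; exact: nbhs_dnbhs_neq.
rewrite /q normrZ normfV ler_pdivrMl ?normr_gt0//=.
apply: (le_trans (f_lip _ _)).
by rewrite addrK normrZ mulrCA.
Unshelve. all: by end_near. Qed.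

(** A measurable minorant of the norm of the gradient, equal to it wherever all
    partial derivatives exist. *)
Definition grad_norm (x : 'rV[R]_n) : R :=
  euclidean_norm (\row_i partial_deriv f i x).

Lemma euclidean_norm_ge0 (v : 'rV[R]_n) : 0 <= euclidean_norm v.
Proof. exact: sqrtr_ge0. Qed.

Lemma le_euclidean_norm (u v : 'rV[R]_n) :
  (forall i, `|u 0 i| <= `|v 0 i|) -> euclidean_norm u <= euclidean_norm v.
Proof.
move=> uv; apply: ler_wsqrtr; apply: ler_sum => i _.
by rewrite -real_normK ?num_real// -[leRHS]real_normK ?num_real// lerXn2r ?nnegrE.
Qed.

Lemma partial_le_grad_norm i x : `|partial_deriv f i x| <= grad_norm x.
Proof.
rewrite -sqrtr_sqr; apply: ler_wsqrtr; rewrite (bigD1 i)//= mxE lerDl.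
by apply: sumr_ge0 => j _; rewrite sqr_ge0.
Qed.

Lemma grad_norm_le_gradient x : grad_norm x <= euclidean_norm (gradient f x).
Proof.
apply: le_euclidean_norm => i; rewrite !mxE /partial_deriv.
by case: asboolP => // _; rewrite normr0.
Qed.

Lemma grad_norm_bound : exists2 M, 0 <= M & forall x, grad_norm x <= M.
Proof.
exists (euclidean_norm (\row_i (K * `|delta_mx 0 i : 'rV[R]_n|))).
  exact: euclidean_norm_ge0.
move=> x; apply: le_euclidean_norm => i; rewrite !mxE.
by apply: (le_trans (partial_deriv_bound i x)); rewrite ler_norm.
Qed.

Lemma measurable_grad_norm : measurable_fun setT grad_norm.
Proof.
rewrite /grad_norm /euclidean_norm.
apply: measurableT_comp.
  by apply: continuous_measurable_fun; exact: sqrt_continuous.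
rewrite (_ : (fun x => _) = (fun x => \sum_(i < n) partial_deriv f i x ^+ 2)); last first.
  by apply/funext => x; apply: eq_bigr => i _; rewrite mxE.
apply: measurable_sum => i; apply: measurable_funX.
exact: measurable_partial_deriv f_lip.
Qed.

End gradient_norm.

Section lower_integral.
Local Open Scope ereal_scope.
Context d (T : measurableType d) (R : realType).
Variable mu : {measure set T -> \bar R}.

(** The integral of a nonnegative function is a supremum over the simple
    functions below it. In this sense [grad_norm f] is compared with the norm of
    the gradient of [f], whose values are arbitrary where a partial derivative
    does not exist, so that it may fail to be measurable. *)
Lemma ge0_le_integral_lower (f g : T -> \bar R) :
  (forall x, 0 <= f x) -> (forall x, f x <= g x) ->
  \int[mu]_x f x <= \int[mu]_x g x.
Proof.
move=> f0 fg; rewrite !ge0_integralTE//; last by move=> x; exact: le_trans (fg x).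
apply: ereal_sup_le => _ [h /= hf <-].
by exists h => // x; exact: le_trans (hf x) (fg x).
Qed.

End lower_integral.

(** * Sums over the dyadic cubes *)

Section dyadic_sums.
Context {R : realType} {n : nat}.
Notation cell := ('rV[R]_n.+1 * R)%type.
Notation pos := {ffun 'I_n.+1 -> bool}.
Implicit Types (c : cell) (e : pos).

Lemma cell_nonempty c : 0 < c.2 -> cell_set c !=set0.
Proof.
move=> l0; exists (\row_i (c.1 0 i + c.2 / 2)) => i; rewrite mxE.
by apply/andP; split; lra.
Qed.

Lemma bisection_child c e : 0 < c.2 ->
  bisection (cell_set c) (cell_set (cell_child c e)).
Proof. by move=> l0; exists c.1, c.2, e. Qed.

Lemma bisection_cell (Q S : set 'rV[R]_n.+1) : bisection Q S ->
  exists c e, [/\ 0 < c.2, Q = cell_set c & S = cell_set (cell_child c e)].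
Proof.
move=> [a [l [e [l0 QE SE]]]]; exists (a, l), [ffun i => e i]; split => //.
rewrite SE /cell_set /cell_child /=; congr cube.
by apply/rowP => i; rewrite !mxE ffunE.
Qed.

Lemma dyadic_sub (Q S : set 'rV[R]_n.+1) : dyadic Q S -> S `<=` Q.
Proof.
elim => // {}S T _ IH /bisection_cell[c [e [c0 SE ->]]].
by apply: subset_trans IH; rewrite SE; exact: cell_child_sub.
Qed.

Lemma dyadic_nonempty c S : 0 < c.2 -> dyadic (cell_set c) S -> S !=set0.
Proof.
move=> c0; elim => [|{}S T _ _ /bisection_cell[c' [e [c'0 _ ->]]]].
  exact: cell_nonempty.
by apply: cell_nonempty; rewrite /= divr_gt0.
Qed.

Lemma dyadic_trans (P Q S : set 'rV[R]_n.+1) :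
  dyadic P Q -> dyadic Q S -> dyadic P S.
Proof. by move=> PQ; elim => // S' T _ PS ST; exact: dyadic_bisection PS ST. Qed.

Lemma dyadic_child c e : 0 < c.2 ->
  dyadic (cell_set c) (cell_set (cell_child c e)).
Proof.
by move=> c0; apply: (dyadic_bisection (dyadic_refl _)); exact: bisection_child.
Qed.

Lemma cell_not_sub_child c e : 0 < c.2 ->
  ~ (cell_set c `<=` cell_set (cell_child c e)).
Proof.
move=> c0 H; pose e' : pos := [ffun i => ~~ e i].
have [x xe'] : cell_set (cell_child c e') !=set0.
  by apply: cell_nonempty; rewrite /= divr_gt0.
have xe := H _ (cell_child_sub c0 xe').
have /ffunP/(_ ord0) := cell_child_disj c0 xe xe'.
by rewrite ffunE; case: (e ord0).
Qed.

Local Open Scope ereal_scope.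

Lemma subset_esum (T : choiceType) (A B : set T) (a : T -> \bar R) :
  (forall x, 0 <= a x) -> A `<=` B -> \esum_(i in A) a i <= \esum_(i in B) a i.
Proof.
move=> a0 AB; apply: ereal_sup_le => _ [F [finF FA] <-].
by exists F => //; split => //; exact: subset_trans AB.
Qed.

Lemma esum_disjointU (T : choiceType) (A B : set T) (a : T -> \bar R) :
  (forall x, 0 <= a x) -> A `&` B = set0 ->
  \esum_(i in A) a i + \esum_(i in B) a i = \esum_(i in A `|` B) a i.
Proof.
move=> a0 AB; rewrite (esumID B (A `|` B))//.
rewrite setIUl AB set0U setIid addeC; congr (_ + _).
rewrite setIUl setICr setU0; congr (esum _ _).
by apply/esym/setIidPl; apply/subsets_disjoint; rewrite setCK.
Qed.

(** The dyadic families of distinct children are disjoint, since their members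
    are nonempty subsets of disjoint cubes, and they do not contain the cell
    itself, since a child misses the other children. *)
Lemma esum_dyadic_child c (w : set 'rV[R]_n.+1 -> \bar R) : (0 < c.2)%R ->
  (forall S, 0 <= w S) ->
  w (cell_set c) + \sum_e \esum_(S in dyadic (cell_set (cell_child c e))) w S <=
  \esum_(S in dyadic (cell_set c)) w S.
Proof.
move=> c0 w0.
have child0 e : (0 < (cell_child c e).2)%R by rewrite /= divr_gt0.
pose J e := dyadic (cell_set (cell_child c e)).
have seqE (s : seq pos) : uniq s ->
    \sum_(e <- s) \esum_(S in J e) w S = \esum_(S in \bigcup_(e in [set` s]) J e) w S.
  elim: s => [|e s IH] /=.
    rewrite big_nil (_ : [set` [::]] = set0) ?bigcup_set0 ?esum_set0//.
    by apply/seteqP; split.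
  move=> /andP[es us]; rewrite big_cons IH//.
  have -> : \bigcup_(e' in [set` e :: s]) J e' = J e `|` \bigcup_(e' in [set` s]) J e'.
    apply/seteqP; split => [S [e' /=]|S [Se|[e' e's Se']]].
    - by rewrite inE => /predU1P[->|e's] Se'; [left|right; exists e'].
    - by exists e => //=; rewrite mem_head.
    - by exists e' => //=; rewrite inE [X in _ || X]e's orbT.
  apply: esum_disjointU => //; apply/seteqP; split => // S [Se [e' /= e's Se']].
  have [x Sx] := dyadic_nonempty (child0 e) Se.
  have ee' := cell_child_disj c0 (dyadic_sub Se Sx) (dyadic_sub Se' Sx).
  by move: es; rewrite ee' e's.
rewrite -big_enum/= seqE ?enum_uniq//.
rewrite -[X in X + _](@esum_set1 _ _ (cell_set c) w)// esum_disjointU//.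
  apply: subset_esum => // S [-> /=|[e _]]; first exact: dyadic_refl.
  exact/dyadic_trans/dyadic_child.
apply/seteqP; split => // S [/= -> [e _]] /dyadic_sub.
exact: cell_not_sub_child.
Qed.

(** Each dyadic cube is reached by one path in the tree, so the sum over the
    nodes of bounded depth counts every cube at most once. *)
Lemma treesum_le_esum (w : set 'rV[R]_n.+1 -> \bar R) (A : Type)
    (ch : A -> pos -> A) (cl : A -> cell) (z : A -> R) d a :
  (forall a, 0 < (cl a).2)%R -> (forall a e, cl (ch a e) = cell_child (cl a) e) ->
  (forall a, (z a)%:E = w (cell_set (cl a))) -> (forall S, 0 <= w S) ->
  (treesum ch z d a)%:E <= \esum_(S in dyadic (cell_set (cl a))) w S.
Proof.
move=> cl0 clch zw w0; elim: d a => [|d IH] a /=; rewrite ?addr0.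
  rewrite zw -[leLHS](@esum_set1 _ _ (cell_set (cl a)) w)//.
  by apply: subset_esum => // S ->; exact: dyadic_refl.
apply: le_trans (esum_dyadic_child (cl0 a) w0).
rewrite EFinD zw leeD2l// -sumEFin; apply: lee_sum => e _.
by rewrite -clch; exact: IH.
Qed.

End dyadic_sums.

(** * Integration on cells *)

Section cell_integrals.
Context {R : realType} {n : nat}.
Notation N := n.+1.
Notation mu := (@lebesgue_rV R N).
Notation CT := (@lebesgue_space R N).
Notation cell := ('rV[R]_N * R)%type.
Implicit Types (c : cell) (phi psi : CT -> R) (D : set CT).

Lemma measurable_cellC c : measurable (cell_set c : set CT).
Proof. exact: (measurable_completed (measurable_cell c)). Qed.

Lemma lebesgue_cell_lty c : 0 < c.2 -> (mu (cell_set c) < +oo)%E.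
Proof. by move=> c0; rewrite lebesgue_cell// ltry. Qed.

Lemma cell_integrable_bounded c phi M : 0 < c.2 ->
  measurable_fun (cell_set c : set CT) phi ->
  (forall x, cell_set c x -> `|phi x| <= M) ->
  mu.-integrable (cell_set c) (EFin \o phi).
Proof.
move=> c0 mphi phiM; apply: measurable_bounded_integrable => //.
- exact: measurable_cellC.
- exact: lebesgue_cell_lty.
- exists M; split; first exact: num_real.
  by move=> y My x cx; exact: le_trans (phiM x cx) (ltW My).
Qed.

Lemma cell_integrable_dominated c phi psi :
  measurable_fun (cell_set c : set CT) phi ->
  mu.-integrable (cell_set c) (EFin \o psi) ->
  (forall x, cell_set c x -> 0 <= phi x <= psi x) ->
  mu.-integrable (cell_set c) (EFin \o phi).
Proof.
move=> mphi ipsi H; apply: le_integrable ipsi => //.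
- exact: measurable_cellC.
- exact/measurable_EFinP.
- move=> x /H /andP[h0 h1] /=; rewrite lee_fin !ger0_norm//.
  exact: le_trans h1.
Qed.

Lemma cell_integrableS c c' phi : cell_set c' `<=` cell_set c ->
  mu.-integrable (cell_set c) (EFin \o phi) ->
  mu.-integrable (cell_set c') (EFin \o phi).
Proof.
by move=> cc'; apply: integrableS => //; exact: measurable_cellC.
Qed.

Lemma Rintegral_cell_cst c (k : R) : 0 < c.2 ->
  \int[mu]_(x in cell_set c) k = k * c.2 ^+ N.
Proof.
move=> c0; rewrite Rintegral_cst; last exact: measurable_cellC.
by have := lebesgue_cell c0 => /= ->.
Qed.

Lemma Rintegral_cell_child c phi : 0 < c.2 ->
  mu.-integrable (cell_set c) (EFin \o phi) ->
  (forall x, cell_set c x -> 0 <= phi x) ->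
  \sum_e \int[mu]_(x in cell_set (cell_child c e)) phi x =
  \int[mu]_(x in cell_set c) phi x.
Proof.
move=> c0 iphi phi0; apply: EFin_inj.
rewrite /Rintegral fineK; last first.
  by apply: integrable_fin_num => //; exact: measurable_cellC.
rewrite (@integral_cell_child _ _ c (EFin \o phi))//; last first.
  exact: (measurable_int mu).
rewrite -sumEFin; apply: eq_bigr => e _; rewrite fineK//.
apply: integrable_fin_num; first exact: measurable_cellC.
by apply: cell_integrableS iphi; exact: cell_child_sub.
Qed.

Lemma cell_dist c x y : cell_set c x -> cell_set c y -> `|x - y| <= c.2.
Proof.
move=> cx cy; have [c0|c0] := ltP 0 c.2; last first.
  by have /andP[h1 h2] := cx ord0; lra.
have : ball x c.2 y.
  split => // j i; rewrite ord1 ball_itv /= in_itv/=.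
  have /andP[? ?] := cx i; have /andP[? ?] := cy i.
  by apply/andP; split; lra.
by rewrite mx_norm_ball => /ltW.
Qed.

Definition cell_average (phi : CT -> R) c :=
  (\int[mu]_(x in cell_set c) phi x) / c.2 ^+ N.

Lemma cell_average_bounds c phi a b : 0 < c.2 ->
  mu.-integrable (cell_set c) (EFin \o phi) ->
  (forall x, cell_set c x -> a <= phi x <= b) ->
  a <= cell_average phi c <= b.
Proof.
move=> c0 iphi ab; have v0 : 0 < c.2 ^+ N by rewrite exprn_gt0.
have icst k : mu.-integrable (cell_set c) (EFin \o (fun=> k)).
  by apply: (@cell_integrable_bounded _ _ `|k|).
rewrite /cell_average ler_pdivlMr// ler_pdivrMr// -!Rintegral_cell_cst//.
apply/andP; split; apply: le_Rintegral => //; try exact: measurable_cellC.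
- by move=> x /ab /andP[].
- by move=> x /ab /andP[].
Qed.

Lemma cell_average_dist c (f : 'rV[R]_N -> R) K x : 0 < c.2 -> 0 <= K ->
  (forall x y, `|f x - f y| <= K * `|x - y|) ->
  mu.-integrable (cell_set c) (EFin \o f) -> cell_set c x ->
  `|f x - cell_average f c| <= K * c.2.
Proof.
move=> c0 K0 lip fi cx.
suff : f x - K * c.2 <= cell_average f c <= f x + K * c.2.
  by move=> /andP[h1 h2]; rewrite ler_norml; apply/andP; split; lra.
apply: cell_average_bounds => // y cy.
have := le_trans (lip x y) (ler_wpM2l K0 (cell_dist cx cy)).
by rewrite ler_norml => /andP[h1 h2]; apply/andP; split; lra.
Qed.

Lemma powR_le1D (x q t : R) : 0 <= x -> 0 < q -> q <= t -> x `^ q <= 1 + x `^ t.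
Proof.
move=> x0 q0 qt; have [x1|/ltW x1] := leP x 1.
  apply: (@le_trans _ _ 1); last by rewrite lerDl powR_ge0.
  by have := ler_powR_base (ltW q0) x0 x1; rewrite powR1.
by apply: (le_trans (ler_powR x1 qt)); rewrite lerDr.
Qed.

(** Hoelder's inequality for [|g|^q] and the constant 1, with exponents [t/q] and
    [1 / (1 - q/t)]. *)
Lemma cell_hoelder c (g : CT -> R) (q t : R) : 0 < c.2 -> 0 < q -> q < t ->
  measurable_fun (cell_set c : set CT) g ->
  mu.-integrable (cell_set c) (EFin \o (fun x => `|g x| `^ t)) ->
  \int[mu]_(x in cell_set c) `|g x| `^ q <=
  (c.2 ^+ N) `^ (1 - q / t) * (\int[mu]_(x in cell_set c) `|g x| `^ t) `^ (q / t).
Proof.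
move=> c0 q0 qt mg ig; have t0 : 0 < t by rewrite (lt_trans q0).
set D := cell_set c; have mD : measurable (D : set CT) by exact: measurable_cellC.
have b0 : 0 < q / t by rewrite divr_gt0.
have b1 : 0 < 1 - q / t by rewrite subr_gt0 ltr_pdivrMr// mul1r.
pose f1 : CT -> R := (fun x => `|g x| `^ q) \_ D.
pose f2 : CT -> R := \1_D.
have mgq : measurable_fun (D : set CT) (fun x => `|g x| `^ q).
  by apply: (measurableT_comp (measurable_powR q)); exact: measurableT_comp.
have mf1 : measurable_fun [set: CT] f1 by apply/(measurable_restrictT _ _).1.
have mf2 : measurable_fun [set: CT] f2 by exact: measurable_indic.
have := @hoelder _ CT R mu f1 f2 (q / t)^-1 (1 - q / t)^-1 mf1 mf2.
rewrite !invr_gt0 !invrK => /(_ b0 b1).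
rewrite addrC subrK => /(_ erefl).
have -> : ('N[mu]_1 [EFin \o (f1 \* f2)%R] = (\int[mu]_(x in D) `|g x| `^ q)%R%:E)%E.
  rewrite Lnorm1 /Rintegral fineK; last first.
    apply: integrable_fin_num => //.
    have i1 : mu.-integrable D (EFin \o (fun x => 1 + `|g x| `^ t)).
      have i2 : mu.-integrable D (EFin \o (fun=> 1 : R)).
        by apply: (@cell_integrable_bounded _ _ 1) => // x _; rewrite normr1.
      have := integrableD mD i2 (ig : mu.-integrable D _).
      by apply: eq_integrable.
    apply: (cell_integrable_dominated mgq i1) => x _.
    by rewrite powR_ge0/= powR_le1D// ltW.
  rewrite [RHS]integral_mkcond; apply: eq_integral => x _.
  rewrite /= /f1 /f2 indicE !patchE; case: ifPn => xD.
    by rewrite mulr1 ger0_norm ?powR_ge0.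
  by rewrite mul0r normr0.
have -> : ('N[mu]_(q / t)^-1%:E [EFin \o f1] =
    ((\int[mu]_(x in D) `|g x| `^ t) `^ (q / t))%R%:E)%E.
  rewrite Lnorm.unlock invrK -poweR_EFin; congr (_ `^ _)%E.
  rewrite /Rintegral fineK; last exact: integrable_fin_num.
  rewrite [RHS]integral_mkcond; apply: eq_integral => x _.
  rewrite /= /f1 !patchE; case: ifPn => xD.
    rewrite ger0_norm ?powR_ge0// -powRrM; congr (_ `^ _)%:E.
    by field; rewrite !gt_eqF.
  by rewrite normr0 powR0// invr_eq0 gt_eqF.
have -> : ('N[mu]_(1 - q / t)^-1%:E [EFin \o f2] =
    ((c.2 ^+ N) `^ (1 - q / t))%R%:E)%E.
  rewrite Lnorm.unlock invrK -poweR_EFin; congr (_ `^ _)%E.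
  rewrite -(lebesgue_cell c0) -[cell_set c]setIT -integral_indic//.
  apply: eq_integral => x _; rewrite /= /f2 indicE.
  by case: (x \in D); rewrite ?normr1 ?powR1// normr0 powR0// invr_eq0 gt_eqF.
by rewrite -EFinM lee_fin mulrC.
Qed.

End cell_integrals.

(** * The estimate for Lipschitz functions on the whole space *)

Section core.
Context {R : realType} {n : nat}.
Notation N := n.+1.
Notation mu := (@lebesgue_rV R N).
Notation CT := (@lebesgue_space R N).
Notation cell := ('rV[R]_N * R)%type.
Notation pos := {ffun 'I_N -> bool}.
Variables (p q t s rho : R).
Hypotheses (p_gt1 : 1 < p) (q_gt0 : 0 < q) (s_gt0 : 0 < s) (rho_gt0 : 0 < rho)
  (q_le_t : q <= t).
Hypothesis pq_rho : q^-1 = p^-1 + rho^-1.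
Hypothesis pq_s : q^-1 = p^-1 + s^-1 - N%:R^-1.
Variables (f : 'rV[R]_N -> R) (K : R).
Hypothesis K_gt0 : 0 < K.
Hypothesis f_lip : forall x y, `|f x - f y| <= K * `|x - y|.
Hypothesis f_ge0 : forall x, 0 <= f x.
Variables (c0 : cell) (g : CT -> R).
Hypothesis c0_gt0 : 0 < c0.2.
Hypothesis g_meas : measurable_fun (cell_set c0 : set CT) g.
Hypothesis g_int : mu.-integrable (cell_set c0) (EFin \o (fun x => `|g x| `^ t)).

Let t_gt0 : 0 < t. Proof. exact: lt_le_trans q_le_t. Qed.

(** The dyadic tree is indexed by the cells of positive side inside [c0], so that
    the hypotheses of [tree_bound] hold at every node. *)
Definition subcell := {c : cell | 0 < c.2 /\ cell_set c `<=` cell_set c0}.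

Lemma subcell_child_subproof (a : subcell) (e : pos) :
  0 < (cell_child (sval a) e).2 /\ cell_set (cell_child (sval a) e) `<=` cell_set c0.
Proof.
case: a => c [c_gt0 cc0] /=; split; first by rewrite divr_gt0.
by apply: subset_trans cc0; exact: cell_child_sub.
Qed.

Definition subcell_child (a : subcell) (e : pos) : subcell :=
  exist _ _ (subcell_child_subproof a e).

Definition subcell_root : subcell := exist _ c0 (conj c0_gt0 (@subset_refl _ _)).

Implicit Types a : subcell.

Definition subcell_len a := (sval a).2.
Definition subcell_int (phi : CT -> R) a := \int[mu]_(x in cell_set (sval a)) phi x.
Local Notation I := subcell_int.
Local Notation len := subcell_len.

Let h := grad_norm f.
Let gpow r (x : CT) := `|g x| `^ r.
Let dev a T (x : CT) := gpow q x * (`|f x - cell_average f (sval a)| + T) `^ q.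

Let len_gt0 a : 0 < len a. Proof. by case: a => c []. Qed.
Let sub0 a : cell_set (sval a) `<=` cell_set c0. Proof. by case: a => c []. Qed.
Let mcell a : measurable (cell_set (sval a) : set CT).
Proof. exact: measurable_cellC. Qed.

Let inherit phi a : mu.-integrable (cell_set c0) (EFin \o phi) ->
  mu.-integrable (cell_set (sval a)) (EFin \o phi).
Proof. exact: cell_integrableS (@sub0 a). Qed.

Let mg a : measurable_fun (cell_set (sval a) : set CT) g.
Proof. by apply: measurable_funS g_meas => //; exact: measurable_cellC. Qed.

Let mgpow r a : measurable_fun (cell_set (sval a) : set CT) (gpow r).
Proof.
apply: (measurableT_comp (measurable_powR r)).
by apply: measurableT_comp => //; exact: mg.
Qed.

Let h_ge0 x : 0 <= h x. Proof. exact: euclidean_norm_ge0. Qed.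

Let mh a : measurable_fun (cell_set (sval a) : set CT) (h : CT -> R).
Proof.
apply: measurable_fun_completed; first exact: measurable_cell.
exact: measurable_funS (measurable_grad_norm f_lip).
Qed.

Let ih : mu.-integrable (cell_set c0) (EFin \o h).
Proof.
have [M M0 hM] := grad_norm_bound f_lip.
apply: (@cell_integrable_bounded _ _ _ _ M) => //; first exact: (@mh subcell_root).
by move=> x _; rewrite ger0_norm//; exact: hM.
Qed.

Let ihp : mu.-integrable (cell_set c0) (EFin \o (fun x => h x `^ p)).
Proof.
have [M M0 hM] := grad_norm_bound f_lip.
apply: (cell_integrable_bounded (M := M `^ p) c0_gt0).
  by apply: (measurableT_comp (measurable_powR p)); exact: (@mh subcell_root).
move=> x _; rewrite ger0_norm ?powR_ge0//.
apply: ler_powR_base (h_ge0 x) (hM x).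
by rewrite ltW// (lt_trans _ p_gt1).
Qed.

Let mf a : measurable_fun (cell_set (sval a) : set CT) (f : CT -> R).
Proof.
apply: measurable_fun_completed; first exact: measurable_cell.
apply: (measurable_funS measurableT) => //.
by apply: continuous_measurable_rV; exact: lipschitz_continuous_rV f_lip.
Qed.

Let if_ : mu.-integrable (cell_set c0) (EFin \o f).
Proof.
have [x0 x0c] := cell_nonempty c0_gt0.
apply: (@cell_integrable_bounded _ _ _ _ (f x0 + K * c0.2)) => //.
  exact: (@mf subcell_root).
move=> x cx; rewrite ger0_norm//.
have := le_trans (f_lip x x0) (ler_wpM2l (ltW K_gt0) (cell_dist cx x0c)).
by rewrite ler_norml => /andP[_]; lra.
Qed.

(** [|g|^q <= 1 + |g|^t] as [q <= t]. *)
Let igq : mu.-integrable (cell_set c0) (EFin \o gpow q).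
Proof.
have i2 : mu.-integrable (cell_set c0) (EFin \o (fun=> 1 : R)).
  by apply: (@cell_integrable_bounded _ _ _ _ 1) => // x _; rewrite normr1.
have i1 : mu.-integrable (cell_set c0) (EFin \o (fun x => 1 + gpow t x)).
  by have := integrableD (mcell subcell_root) i2 g_int; apply: eq_integrable.
apply: (cell_integrable_dominated (@mgpow q subcell_root) i1) => x _.
by rewrite powR_ge0/= powR_le1D.
Qed.

Let iscale k phi a : mu.-integrable (cell_set (sval a)) (EFin \o phi) ->
  mu.-integrable (cell_set (sval a)) (EFin \o (fun x => k * phi x)).
Proof.
move=> i1; have := integrableZl (mcell a) k i1.
by apply: eq_integrable.
Qed.

Let idev (a b : subcell) (T : R) : 0 <= T -> cell_set (sval b) `<=` cell_set (sval a) ->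
  mu.-integrable (cell_set (sval b)) (EFin \o dev a T).
Proof.
move=> T0 ba.
have i1 := @iscale ((K * len a + T) `^ q) _ _ (inherit b igq).
apply: (cell_integrable_dominated _ i1).
  apply: measurable_funM; first exact: mgpow.
  apply: (measurableT_comp (measurable_powR q)).
  move: (cell_average f (sval a)) => av.
  apply: measurable_funD; last exact: measurable_cst.
  apply: (measurableT_comp (@normr_measurable R setT)).
  by apply: measurable_funB; [exact: mf|exact: measurable_cst].
move=> x bx; apply/andP; split; first by apply: mulr_ge0; exact: powR_ge0.
rewrite /dev mulrC; apply: ler_wpM2r; first exact: powR_ge0.
apply: ler_powR_base; [exact: ltW|by rewrite addr_ge0|rewrite lerD2r].
apply: cell_average_dist => //; [exact: (len_gt0 a)|exact: ltW|exact: inherit|exact: ba].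
Qed.

Let I_ge0 phi a : (forall x, 0 <= phi x) -> 0 <= I phi a.
Proof. by move=> phi0; apply: Rintegral_ge0. Qed.

Let I_child phi a : mu.-integrable (cell_set c0) (EFin \o phi) ->
  (forall x, 0 <= phi x) -> \sum_e I phi (subcell_child a e) = I phi a.
Proof.
move=> i1 phi0; apply: Rintegral_cell_child => //; first exact: (len_gt0 a).
exact: inherit.
Qed.

Let average_child a e :
  `|cell_average f (sval a) - cell_average f (sval (subcell_child a e))| <=
  2 ^+ N * len a * (I h a / len a ^+ N).
Proof.
have mfE : measurable_fun setT (EFin \o f).
  apply/measurable_EFinP; apply: continuous_measurable_rV.
  exact: lipschitz_continuous_rV f_lip.
have mhE : measurable_fun setT (EFin \o h).
  by apply/measurable_EFinP; exact: measurable_grad_norm f_lip.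
have E (phi : 'rV[R]_N -> R) c : measurable_fun setT (EFin \o phi) ->
    (forall x, 0 <= phi x) ->
    (\int[mu]_(x in cell_set c) (phi x)%:E =
     \int[@lebesgue_borel R N]_(x in cell_set c) (phi x)%:E)%E.
  move=> mphi phi0; rewrite integral_completed//; first exact: measurable_cell.
    exact: measurable_funS mphi.
  by move=> x _; rewrite lee_fin.
rewrite distrC /cell_average /I /subcell_int /Rintegral !E//.
apply: (@child_average_le _ _ f K (EFin \o h)) => //.
- by move=> i x; rewrite lee_fin; exact: partial_le_grad_norm.
- exact: (len_gt0 a).
- have := integrable_fin_num (mcell a) (inherit a if_).
  by rewrite E// fin_numElt => /andP[].
- have := integrable_fin_num (mcell a) (inherit a ih).
  by rewrite E// fin_numElt => /andP[].
Qed.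

Let W a := (len a ^+ N) `^ (1 - q / t) * I (gpow t) a `^ (q / t).
Let avg a := I h a / len a ^+ N.

Let gpow_ge0 r x : 0 <= gpow r x. Proof. exact: powR_ge0. Qed.

Let p_gt0 : 0 < p. Proof. by rewrite (lt_trans _ p_gt1). Qed.

Let young a (E b : R) : 0 <= E -> 0 <= b ->
  E * b `^ (p - 1) * I h a <=
  E `^ p * I (fun x => h x `^ p) a + b `^ p * len a ^+ N.
Proof.
move=> E0 b0; have ia1 := inherit a ih; have ia2 := inherit a ihp.
rewrite -Rintegral_cell_cst; last exact: (len_gt0 a).
rewrite /subcell_int -!RintegralZl// -RintegralD//; last 2 first.
- exact: iscale.
- by apply: (@cell_integrable_bounded _ _ _ _ `|b `^ p|) => //; exact: (len_gt0 a).
apply: le_Rintegral => //.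
- exact: iscale.
- have i1 := @iscale (E `^ p) _ _ ia2.
  have i2 : mu.-integrable (cell_set (sval a)) (EFin \o (fun=> b `^ p)).
    by apply: (@cell_integrable_bounded _ _ _ _ `|b `^ p|) => //; exact: (len_gt0 a).
  by have := integrableD (mcell a) i1 i2; apply: eq_integrable.
- by move=> x _; apply: young_powR.
Qed.

Section weight.
Variables (V : subcell -> R -> R) (A0 A1 : R).
Hypotheses (A0_ge0 : 0 <= A0) (A1_ge0 : 0 <= A1).
Hypothesis V_ch : forall a (b : R), 0 < b -> \sum_e V (subcell_child a e) b <= V a b.
Hypothesis V_ge : forall a (b : R), 0 < b -> I (gpow q) a <= V a b.
Hypothesis V_jump : forall a (b S x : R), 0 < b -> 2 * b < avg a -> 0 <= S -> 0 <= x ->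
  (S + x) `^ q * V a (avg a) <= S `^ q * V a b + A0 * x `^ q * W a.
Hypothesis V_start : forall a, 0 < avg a -> V a (avg a) <= A1 * W a.

(** [tree_bound] for integrals. Passing to a child moves the average by at most
    [2^N * len a * avg a], and on [a] the function deviates from its
    average by at most [K * len a]. *)
Lemma weighted_cell_estimate Z :
  (forall d, treesum subcell_child (morrey_term N s rho t len (I (gpow t))) d
    subcell_root <= Z) ->
  I (dev subcell_root 0) subcell_root <=
  tree_const p q (2 ^+ N) A0 A1 *
  (I (fun x => h x `^ p) subcell_root `^ (q / p) * Z `^ (q / rho)).
Proof.
move=> hZ.
apply: (@tree_bound R pos subcell subcell_child N p q s rho t _ p_gt1 q_gt0 s_gt0
  rho_gt0 t_gt0 pq_rho pq_s len (I h) (I (fun x => h x `^ p)) (I (gpow q))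
  (I (gpow t)) (fun a T => I (dev a T) a) V (2 ^+ N) K A0 A1) => //.
- exact: ltW.
- by move=> a; exact: I_ge0.
- by move=> a; apply: I_ge0 => x; exact: powR_ge0.
- by move=> a; exact: I_ge0.
- move=> a; rewrite (eq_bigr (fun=> (len a / 2) ^+ N))//.
  rewrite sumr_const card_ffun card_bool card_ord.
  by rewrite expr_div_n -[LHS]mulr_natr natrX divfK// expf_neq0.
- by move=> a; exact: I_child.
- by move=> a; apply: I_child => // x; exact: powR_ge0.
- by move=> a; exact: I_child.
- move=> a T T' T0 TT'.
  have dev_ge0 b S x : 0 <= dev b S x by apply: mulr_ge0; exact: powR_ge0.
  have dev_child := Rintegral_cell_child (len_gt0 a) (idev T0 (@subset_refl _ _))
    (fun x _ => dev_ge0 a T x).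
  rewrite /subcell_int -dev_child.
  have D0 : 0 <= 2 ^+ N * len a * (I h a / len a ^+ N).
    apply: mulr_ge0; first by rewrite mulr_ge0 ?exprn_ge0// ltW.
    by rewrite divr_ge0 ?I_ge0// exprn_ge0// ltW.
  have T'0 : 0 <= T' by apply: le_trans TT'; rewrite addr_ge0.
  apply: ler_sum => e _; apply: le_Rintegral.
  + exact: mcell (subcell_child a e).
  + apply: (@idev a (subcell_child a e)) => //.
    exact: cell_child_sub (len_gt0 a).
  + exact: (@idev (subcell_child a e) (subcell_child a e)).
  + move=> x xe; apply: ler_wpM2l; first exact: powR_ge0.
    apply: ler_powR_base; [exact: ltW|by rewrite addr_ge0|].
    have := average_child a e.
    have := ler_distD (cell_average f (sval (subcell_child a e))) (f x)
      (cell_average f (sval a)).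
    rewrite (distrC (cell_average f (sval a))); lra.
- move=> a T T0; rewrite /subcell_int -RintegralZl//; last exact: inherit.
  apply: le_Rintegral => //.
  + exact: idev.
  + by apply: iscale; exact: inherit.
  + move=> x xa; rewrite /dev mulrC; apply: ler_wpM2r; first exact: powR_ge0.
    apply: ler_powR_base; [exact: ltW|by rewrite addr_ge0|].
    rewrite addrC lerD2l; apply: cell_average_dist => //.
    * exact: (len_gt0 a).
    * exact: ltW.
    * exact: inherit.
Qed.

End weight.

Let hE a : I h a = avg a * len a ^+ N.
Proof. by rewrite divfK// gt_eqF// exprn_gt0. Qed.

Let treesum_le Z := forall d,
  treesum subcell_child (morrey_term N s rho t len (I (gpow t))) d subcell_root <= Z.

Let estimate C Z := (\int[mu]_(x in cell_set c0)
    (`|g x| `^ q * `|f x - cell_average f c0| `^ q)%:E <=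
  (C * ((\int[mu]_(x in cell_set c0) grad_norm f x `^ p)%R `^ (q / p) *
    Z `^ (q / rho)))%:E)%E.

Let estimateE C Z : I (dev subcell_root 0) subcell_root <=
    C * (I (fun x => h x `^ p) subcell_root `^ (q / p) * Z `^ (q / rho)) ->
  estimate C Z.
Proof.
rewrite -lee_fin; apply: le_trans; rewrite le_eqVlt; apply/orP; left; apply/eqP.
rewrite /subcell_int /Rintegral fineK; last first.
  apply: integrable_fin_num; first exact: (mcell subcell_root).
  exact: (@idev subcell_root subcell_root).
by apply: eq_integral => x _; rewrite /dev /gpow /= addr0.
Qed.

Lemma cell_estimate_gt A Z : q < t -> 0 <= A -> jump_const q t A -> treesum_le Z ->
  estimate (tree_const p q (2 ^+ N) A (weight_const q t - 1)) Z.
Proof.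
move=> qt A_ge0 hA hZ; apply: estimateE.
have v0 a : 0 < len a ^+ N by rewrite exprn_gt0.
have hoelderW a : I (gpow q) a <= W a.
  exact: cell_hoelder (len_gt0 a) q_gt0 qt (@mg a) (inherit a g_int).
apply: (@weighted_cell_estimate
  (fun a b => tree_weight q t (I h a) (I (gpow t) a) (I (gpow q) a) b)) => //.
- by rewrite subr_ge0 ltW// weight_const_gt1.
- move=> a b b0; apply: le_trans (tree_weight_sum q_gt0 qt _ b0 _ _) _.
  + by move=> e; exact: I_ge0.
  + by move=> e; exact: I_ge0.
  + by rewrite !I_child.
- by move=> a b b0; exact: tree_weight_ge.
- move=> a b S x b0 ha S0 x0; rewrite hE; apply: hA => //; exact: I_ge0.
- by move=> a ha; rewrite hE; apply: tree_weight_start => //; exact: I_ge0.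
Qed.

(** For [q <= 1] the weight is the integral of [|g|^q] at every level, and the
    jumps are paid by the subadditivity of the power. *)
Lemma cell_estimate_le1 Z : q <= 1 -> t = q -> treesum_le Z ->
  estimate (tree_const p q (2 ^+ N) 1 1) Z.
Proof.
move=> q1 tq hZ; apply: estimateE.
have WE a : W a = I (gpow q) a.
  rewrite /W tq divff ?gt_eqF// subrr powRr0 mul1r powRr1//.
  exact: I_ge0.
apply: (@weighted_cell_estimate (fun a _ => I (gpow q) a)) => //.
- by move=> a b b0; rewrite I_child.
- move=> a b S x b0 ha S0 x0; rewrite -/(W a) WE -mulrDl ler_wpM2r ?I_ge0//.
  by rewrite mul1r powR_subadditive.
- by move=> a ha; rewrite -/(W a) WE mul1r.
Qed.

End core.

(** * Extension of Lipschitz functions and norms *)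

Section lipschitz_extension.
Context {R : realType} {n : nat}.
Notation V := 'rV[R]_n.

Lemma lipschitz_on_bound (Q : set V) (f : V -> R) :
  [lipschitz f x | x in Q] ->
  exists2 K, 0 < K & forall x y, Q x -> Q y -> `|f x - f y| <= K * `|x - y|.
Proof.
move=> [M [Mr HM]]; exists (`|M| + 1); first by rewrite ltr_wpDl.
move=> x y Qx Qy; have := HM (`|M| + 1).
rewrite (le_lt_trans (ler_norm M)) ?ltrDl// => /(_ isT).
by move=> /(_ (x, y)); apply.
Qed.

(** The extension is [F x = inf (f y + K * |x - y|)] over [y] in [Q], an infimum
    of functions of [x] with Lipschitz constant [K]. *)
Lemma mcshane_extension (Q : set V) (f : V -> R) K : Q !=set0 -> 0 < K ->
  (forall x y, Q x -> Q y -> `|f x - f y| <= K * `|x - y|) ->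
  exists2 F : V -> R, forall x y, `|F x - F y| <= K * `|x - y| &
    forall x, Q x -> F x = f x.
Proof.
move=> [x0 Qx0] K0 lip.
pose S x := [set f y + K * `|x - y| | y in Q].
have lb x y : Q y -> f x0 - K * `|x - x0| <= f y + K * `|x - y|.
  move=> Qy; have := lip _ _ Qx0 Qy; rewrite ler_norml => /andP[_ h1].
  have h2 := ler_distD x x0 y; rewrite (distrC x0 x) in h2.
  have := ler_wpM2l (ltW K0) h2; lra.
have infS x : has_inf (S x).
  split; first by exists (f x0 + K * `|x - x0|), x0.
  by exists (f x0 - K * `|x - x0|) => _ [y Qy <-]; exact: lb.
have half x y : inf (S x) <= inf (S y) + K * `|x - y|.
  rewrite -lerBlDr; apply: lb_le_inf; first by case: (infS y).
  move=> _ [z Qz <-]; rewrite lerBlDr.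
  apply: (@le_trans _ _ (f z + K * `|x - z|)).
    by apply: ge_inf; [case: (infS x)|exists z].
  have := ler_wpM2l (ltW K0) (ler_distD y x z); lra.
exists (fun x => inf (S x)) => [x y|x Qx].
  rewrite ler_norml; apply/andP; split.
    by have := half y x; rewrite distrC; lra.
  by have := half x y; lra.
apply/le_anti/andP; split.
  apply: ge_inf; first by case: (infS x).
  by exists x => //; rewrite subrr normr0 mulr0 addr0.
apply: lb_le_inf; first by case: (infS x).
move=> _ [y Qy <-]; have := lip _ _ Qx Qy; rewrite ler_norml => /andP[_]; lra.
Qed.

Lemma lipschitz_max0 (F : V -> R) K B :
  (forall x y, `|F x - F y| <= K * `|x - y|) ->
  forall x y, `|Num.max 0 (F x + B) - Num.max 0 (F y + B)| <= K * `|x - y|.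
Proof.
move=> lip x y; apply: le_trans (lip x y).
rewrite ler_norml; apply/andP; split.
  have := ler_norm (F y - F x); rewrite distrC => h.
  have := normr_ge0 (F x - F y); move: h.
  by case: (leP 0 (F x + B)) => ?; case: (leP 0 (F y + B)) => ?; lra.
have h := ler_norm (F x - F y); have := normr_ge0 (F x - F y); move: h.
by case: (leP 0 (F x + B)) => ?; case: (leP 0 (F y + B)) => ?; lra.
Qed.

(** The difference quotients of [f] and [F] at [x] agree near 0. *)
Lemma gradient_local (f F : V -> R) B x :
  (\near x, F x = f x + B) -> gradient F x = gradient f x.
Proof.
move=> FfB; apply/rowP => i; rewrite !mxE.
rewrite (@near_eq_derive _ _ _ F (fun y => f y + B) x _ FfB) /derive.
rewrite (_ : (fun h : R => h^-1 *: _) =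
  (fun h : R => h^-1 *: ((f \o shift x) (h *: delta_mx 0 i) - f x)))//.
by apply/funext => h /=; congr (_ *: _); ring.
Qed.

End lipschitz_extension.

Section norms.
Context {R : realType} {n : nat}.
Notation mu := (@lebesgue_rV R n).

Lemma LnormOnE (r : R) (Q : set 'rV[R]_n) (f : 'rV[R]_n -> R) : 0 < r ->
  (LnormOn r Q f = (\int[mu]_(x in Q) (`|f x| `^ r)%:E) `^ r^-1)%E.
Proof.
move=> r0; rewrite /LnormOn Lnorm.unlock; congr (_ `^ _)%E.
rewrite [RHS]integral_mkcond; apply: eq_integral => x _.
rewrite !patchE; case: ifP => _ //.
by rewrite abse0 poweR0r// gt_eqF.
Qed.

Lemma EFin_fine_le (x : \bar R) : (0 <= x -> (fine x)%:E <= x)%E.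
Proof. by case: x => [r| |]//= _; rewrite leey. Qed.

Lemma ler_poweR (r : R) (x y : \bar R) : 0 <= r ->
  (0 <= x -> x <= y -> x `^ r <= y `^ r)%E.
Proof.
move=> r0 x0 xy; apply: gt0_ler_poweR => //; rewrite in_itv/= ?x0 ?leey//.
by rewrite (le_trans x0 xy).
Qed.

End norms.

(** * The estimate in terms of the norms *)

Section assembly.
Context {R : realType} {n : nat}.
Notation N := n.+1.
Notation mu := (@lebesgue_rV R N).
Notation CT := (@lebesgue_space R N).
Notation cell := ('rV[R]_N * R)%type.

(** The open cell is a countable union of compact boxes, on each of which [g] is
    integrable. *)
Lemma L1loc_measurable (c : cell) (g : 'rV[R]_N -> R) : L1loc (cell_set c) g ->
  measurable_fun (cell_set c : set CT) (g : CT -> R).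
Proof.
move=> gloc.
pose J (k : nat) (i : 'I_N) : set (measurableTypeR R) :=
  `[c.1 0 i + k.+1%:R^-1, c.1 0 i + c.2 - k.+1%:R^-1]%classic.
pose B k := boxset (J k).
have cB : cell_set c = \bigcup_k B k.
  apply/seteqP; split => x.
    move=> cx.
    have H i : exists k0 : nat, forall k, (k0 <= k)%N -> J k i (x 0 i).
      have /andP[h1 h2] := cx i.
      pose d := Num.min (x 0 i - c.1 0 i) (c.1 0 i + c.2 - x 0 i).
      have d0 : 0 < d by rewrite lt_min; apply/andP; split; lra.
      exists (Num.bound d^-1) => k k0.
      have kd : k.+1%:R^-1 < d.
        rewrite -[ltRHS]invrK ltf_pV2 ?posrE ?invr_gt0//.
        apply: lt_trans (archi_boundP (ltW _)) _; rewrite ?invr_gt0//.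
        by rewrite ltr_nat ltnS.
      move: kd; rewrite /d lt_min /J /= in_itv/= => /andP[].
      move: (k.+1%:R^-1) => w k1 k2.
      by apply/andP; split; lra.
    have [k0 Hk0] := choice H.
    exists (\max_i k0 i)%N => // i; apply: Hk0.
    exact: leq_bigmax.
  move=> [k _ Bx] i; have := Bx i; rewrite /J /= in_itv/= => /andP[h1 h2].
  have k0 : 0 < k.+1%:R^-1 :> R by rewrite invr_gt0.
  by move: k0 h1 h2; move: (k.+1%:R^-1) => w *; apply/andP; split; lra.
rewrite cB; apply/measurable_fun_bigcup => k.
  apply: measurable_completed; apply: measurable_boxset => i.
  exact: measurable_itv.
have cK : compact (B k).
  apply: (@rV_compact R N (fun i => J k i)) => i; exact: segment_compact.
have := gloc _ cK; rewrite cB => /(_ (bigcup_sup _)) => /(_ I) i1.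
exact/measurable_EFinP/(measurable_int mu i1).
Qed.

Variables (p q t s rho C : R).
Hypotheses (p_gt1 : 1 < p) (q_gt0 : 0 < q) (s_gt0 : 0 < s) (rho_gt0 : 0 < rho)
  (q_le_t : q <= t) (C_ge0 : 0 <= C).

(** The common conclusion of [cell_estimate_gt] and [cell_estimate_le1], which
    [norm_estimate] turns into the theorem. *)
Definition lipschitz_cell_estimate := forall (f : 'rV[R]_N -> R) (K : R),
  0 < K -> (forall x y, `|f x - f y| <= K * `|x - y|) -> (forall x, 0 <= f x) ->
  forall (c0 : cell) (g : CT -> R) (c0_gt0 : 0 < c0.2),
  measurable_fun (cell_set c0 : set CT) g ->
  mu.-integrable (cell_set c0) (EFin \o (fun x => `|g x| `^ t)) ->
  forall Z, (forall d, treesum (@subcell_child R n c0)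
      (morrey_term N s rho t (@subcell_len R n c0)
        (@subcell_int R n c0 (fun x => `|g x| `^ t))) d (subcell_root c0_gt0) <= Z) ->
  (\int[mu]_(x in cell_set c0)
    (`|g x| `^ q * `|f x - cell_average f c0| `^ q)%:E <=
  (C * ((\int[mu]_(x in cell_set c0) grad_norm f x `^ p)%R `^ (q / p) *
    Z `^ (q / rho)))%:E)%E.

(** [f] is replaced on [Q] by a nonnegative Lipschitz function [G] on the whole
    space with [G = f + B] on [Q], which has the same gradient there and the same
    deviation from its average. *)
Lemma norm_estimate (Q : set 'rV[R]_N) (f g : 'rV[R]_N -> R) :
  lipschitz_cell_estimate ->
  cubes Q -> [lipschitz f x | x in Q] -> morrey s t rho Q g ->
  (LnormOn q Q (fun x => (g x * (f x - average Q f))%R) <=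
   (C `^ q^-1)%:E * morrey_norm s t rho Q g *
   LnormOn p Q (fun x => euclidean_norm (gradient f x)))%E.
Proof.
move=> core [a [l [l0 QE]]] flip [gloc gnorm].
pose c0 : cell := (a, l); have {}QE : Q = cell_set c0 by [].
have c0_gt0 : 0 < c0.2 by [].
have t_gt0 : 0 < t := lt_le_trans q_gt0 q_le_t.
have p_gt0 : 0 < p := lt_trans ltr01 p_gt1.
have rV_gt0 : 0 < rho^-1 by rewrite invr_gt0.
have mg : measurable_fun (cell_set c0 : set CT) (g : CT -> R).
  by apply: L1loc_measurable; rewrite -QE.
have mgt : measurable_fun (cell_set c0 : set CT) (fun x : CT => `|g x| `^ t).
  apply: (measurableT_comp (measurable_powR t)).
  exact: (measurableT_comp (@normr_measurable R setT)).
(* [Z] is the [rho]-th power of the Morrey norm; its finiteness at the cube [Q]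
   itself makes [|g|^t] integrable. *)
pose w (S : set 'rV[R]_N) : \bar R :=
  ((mu S `^ (s^-1 - t^-1) * LnormOn t S g) `^ rho)%E.
have w0 S : (0 <= w S)%E by exact: poweR_ge0.
pose E := (\esum_(S in dyadic Q) w S)%E.
have E0 : (0 <= E)%E by apply: esum_ge0.
have Efin : (E < +oo)%E by apply: (@lty_poweRy _ E rho^-1) => //; rewrite gt_eqF.
pose Z := fine E; have EZ : E = Z%:E by rewrite /Z fineK// ge0_fin_numE.
have Z0 : 0 <= Z by rewrite /Z fine_ge0.
have muQ c : 0 < c.2 -> mu (cell_set c) = (c.2 ^+ N)%:E by exact: lebesgue_cell.
have igt : mu.-integrable (cell_set c0) (EFin \o (fun x => `|g x| `^ t)).
  have wQ : (w Q < +oo)%E.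
    apply: le_lt_trans Efin; rewrite -[leLHS](@esum_set1 _ _ Q w)//.
    by apply: subset_esum => // S ->; exact: dyadic_refl.
  have {}wQ : (mu Q `^ (s^-1 - t^-1) * LnormOn t Q g < +oo)%E.
    by apply: (@lty_poweRy _ _ rho) wQ; rewrite gt_eqF.
  apply/integrableP; split; first exact/measurable_EFinP.
  have -> : (\int[mu]_(x in cell_set c0) `|(EFin \o (fun x => `|g x| `^ t)%R) x| =
      \int[mu]_(x in Q) (`|g x| `^ t)%R%:E)%E.
    rewrite QE; apply: eq_integral => x _ /=.
    by rewrite ger0_norm ?powR_ge0.
  apply: (@lty_poweRy _ _ t^-1); first by rewrite invr_eq0 gt_eqF.
  rewrite -LnormOnE// ltey; apply/eqP => Loo.
  move: wQ; rewrite Loo QE muQ// poweR_EFin gt0_muley ?ltxx//.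
  by rewrite lte_fin powR_gt0// exprn_gt0.
have hZ d : treesum (@subcell_child R n c0)
    (morrey_term N s rho t (@subcell_len R n c0)
      (@subcell_int R n c0 (fun x => `|g x| `^ t))) d (subcell_root c0_gt0) <= Z.
  rewrite -lee_fin -EZ /E QE.
  apply: (@treesum_le_esum R n w (subcell c0) (@subcell_child R n c0)
    (fun a => sval a) _ d (subcell_root c0_gt0)) => //; first by case=> c [].
  case=> c [c_gt0 cc0]; rewrite /w muQ// LnormOnE// /morrey_term.
  rewrite /subcell_len /subcell_int /=.
  have -> : (\int[mu]_(x in cell_set c) (`|g x| `^ t)%R%:E =
      (\int[mu]_(x in cell_set c) (`|g x| `^ t))%R%:E)%E.
    rewrite /Rintegral fineK//; apply: integrable_fin_num.
      exact: measurable_cellC.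
    exact: cell_integrableS igt.
  by rewrite !poweR_EFin.
(* [B] is chosen so that [f + B >= 0] on [Q], whose diameter is at most [l]. *)
have [K K0 fK] := lipschitz_on_bound flip.
have Qn0 : Q !=set0 by rewrite QE; exact: cell_nonempty.
have [F FK Ff] := mcshane_extension Qn0 K0 fK.
have [x0 Qx0] := Qn0.
pose B := `|F x0| + K * l.
pose G x := Num.max 0 (F x + B).
have GK : forall x y, `|G x - G y| <= K * `|x - y| by exact: lipschitz_max0.
have G0 x : 0 <= G x by rewrite le_max lexx.
have Gf x : Q x -> G x = f x + B.
  move=> Qx; rewrite /G (Ff _ Qx); apply/max_idPr.
  have d : `|x0 - x| <= l by apply: (@cell_dist _ _ c0); rewrite -QE.
  have := le_trans (fK _ _ Qx0 Qx) (ler_wpM2l (ltW K0) d).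
  rewrite /B (Ff _ Qx0) ler_norml => /andP[_].
  by have := ler_norm (- f x0); rewrite normrN; lra.
have main := core G K K0 GK G0 c0 g c0_gt0 mg igt Z hZ.
have mQ : measurable (Q : set CT) by rewrite QE; exact: measurable_cellC.
have iF : mu.-integrable Q (EFin \o F).
  rewrite QE; apply: (@cell_integrable_bounded _ _ _ _ B) => //.
    apply: measurable_fun_completed; first exact: measurable_cell.
    apply: (measurable_funS measurableT) => //.
    by apply: continuous_measurable_rV; exact: lipschitz_continuous_rV FK.
  move=> x cx; rewrite -QE in cx.
  have d : `|x - x0| <= l by apply: (@cell_dist _ _ c0); rewrite -QE.
  have := le_trans (FK x x0) (ler_wpM2l (ltW K0) d).
  by have := ler_distD (F x0) (F x) 0; rewrite !subr0 /B; lra.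
have iB : mu.-integrable Q (EFin \o (fun=> B)).
  by rewrite QE; apply: (@cell_integrable_bounded _ _ _ _ `|B|).
have avgE : cell_average G c0 = average Q f + B.
  have v0 : c0.2 ^+ N != 0 by rewrite gt_eqF// exprn_gt0.
  rewrite /cell_average /average -QE.
  have -> : \int[mu]_(x in Q) G x = \int[mu]_(x in Q) (F x + B).
    by apply: eq_Rintegral => x; rewrite inE => Qx; rewrite Gf// Ff.
  rewrite RintegralD// {2}QE Rintegral_cell_cst//.
  have -> : \int[mu]_(x in Q) F x = \int[mu]_(x in Q) f x.
    by apply: eq_Rintegral => x; rewrite inE => Qx; rewrite Ff.
  by rewrite {2}QE muQ//= mulrDl mulfK// mulrC.
have gradE x : Q x -> gradient G x = gradient f x.
  move=> Qx; apply: (@gradient_local _ _ _ _ B).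
  have : nbhs x Q by apply: open_nbhs_nbhs; split => //; rewrite QE; exact: open_cell.
  by apply: (@filterS _ _ (nbhs_filter x)) => y; exact: Gf.
set Hp := \int[mu]_(x in cell_set c0) grad_norm G x `^ p in main.
have Hp0 : 0 <= Hp by apply: Rintegral_ge0 => x _; exact: powR_ge0.
have HpN : ((Hp `^ p^-1)%:E <=
    LnormOn p Q (fun x => euclidean_norm (gradient f x)))%E.
  rewrite LnormOnE// -poweR_EFin; apply: ler_poweR; rewrite ?invr_ge0 ?(ltW p_gt0)//.
  apply: le_trans (EFin_fine_le _) _.
    by apply: integral_ge0 => x _; rewrite lee_fin powR_ge0.
  rewrite -QE integral_mkcond [leRHS]integral_mkcond.
  apply: ge0_le_integral_lower => x.
    by apply: erestrict_ge0 => y _; rewrite lee_fin powR_ge0.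
  rewrite !patchE; case: ifPn => //; rewrite inE => Qx.
  rewrite lee_fin; apply: ler_powR_base; [exact: ltW|exact: euclidean_norm_ge0|].
  rewrite -(gradE _ Qx) ger0_norm; last exact: euclidean_norm_ge0.
  exact: grad_norm_le_gradient.
have -> : morrey_norm s t rho Q g = (Z `^ rho^-1)%:E.
  by rewrite /morrey_norm -/E EZ poweR_EFin.
apply: (@le_trans _ _
  ((C `^ q^-1)%:E * (Z `^ rho^-1)%:E * (Hp `^ p^-1)%:E)%E); last first.
  by apply: lee_wpmul2l => //; rewrite -EFinM lee_fin mulr_ge0 ?powR_ge0.
rewrite LnormOnE//.
have -> : (\int[mu]_(x in Q) (`|g x * (f x - average Q f)| `^ q)%R%:E =
    \int[mu]_(x in cell_set c0)
      (`|g x| `^ q * `|G x - cell_average G c0| `^ q)%R%:E)%E.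
  rewrite -QE; apply: eq_integral => x; rewrite inE => Qx.
  by rewrite normrM powRM// Gf// avgE opprD addrACA subrr addr0.
apply: le_trans (ler_poweR _ _ main) _.
- by rewrite invr_ge0 ltW.
- by apply: integral_ge0 => x _; rewrite lee_fin mulr_ge0 ?powR_ge0.
rewrite poweR_EFin -!EFinM lee_fin.
rewrite (powRM _ C_ge0 (mulr_ge0 (powR_ge0 _ _) (powR_ge0 _ _))).
rewrite (powRM _ (powR_ge0 _ _) (powR_ge0 _ _)) -!powRrM.
have -> : q / p * q^-1 = p^-1 by rewrite mulrAC divff ?mul1r ?gt_eqF.
have -> : q / rho * q^-1 = rho^-1 by rewrite mulrAC divff ?mul1r ?gt_eqF.
by rewrite -mulrA [Z `^ _ * _]mulrC.
Qed.

End assembly.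

Theorem theorem3p4 (R : realType) (n : nat) (p q r s rho : R) (n_gt0 : (0 < n)%N)
    (p_gt1 : 1 < p) (q_gt0 : 0 < q) (r_gt0 : 0 < r) (s_gt0 : 0 < s)
    (s_lt_rho : s < rho) (q_lt_p : q < p)
    (pq_rho : q^-1 = p^-1 + rho^-1)
    (pq_s : q^-1 = p^-1 + s^-1 - n%:R^-1) :
  exists2 C : R, 0 < C &
    forall (Q : set 'rV[R]_n) (f : 'rV[R]_n -> R),
      cubes Q -> [lipschitz f x | x in Q] ->
      (1 < q < r ->
         forall g : 'rV[R]_n -> R, morrey s r rho Q g ->
           (LnormOn q Q (fun x => (g x * (f x - average Q f))%R) <=
            C%:E * morrey_norm s r rho Q g *
            LnormOn p Q (fun x => euclidean_norm (gradient f x)))%E) /\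
      (q <= 1 ->
         forall g : 'rV[R]_n -> R, morrey s q rho Q g ->
           (LnormOn q Q (fun x => (g x * (f x - average Q f))%R) <=
            C%:E * morrey_norm s q rho Q g *
            LnormOn p Q (fun x => euclidean_norm (gradient f x)))%E).
Proof.
case: n n_gt0 pq_s => // n _ pq_s.
have rho_gt0 : 0 < rho by rewrite (lt_trans s_gt0).
pose bound t C (Q : set 'rV[R]_n.+1) (f g : 'rV[R]_n.+1 -> R) :=
  (LnormOn q Q (fun x => (g x * (f x - average Q f))%R) <=
   C%:E * morrey_norm s t rho Q g *
   LnormOn p Q (fun x => euclidean_norm (gradient f x)))%E.
pose estimate t C := forall Q f g, cubes Q -> [lipschitz f x | x in Q] ->
  morrey s t rho Q g -> bound t C Q f g.
have enlarge t C C' Q f g : C <= C' -> bound t C Q f g -> bound t C' Q f g.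
  move=> CC' /le_trans; apply; apply: lee_wpmul2r; first exact: Lnorm_ge0.
  by apply: lee_wpmul2r; [exact: poweR_ge0|rewrite lee_fin].
have weaken (P : Prop) t C0 : estimate t (C0 `^ q^-1) ->
    exists2 C, 0 < C & P -> estimate t C.
  move=> H; exists (C0 `^ q^-1 + 1) => [|_ Q f g cQ lipf mg].
    by rewrite ltr_wpDl ?powR_ge0.
  by apply: enlarge (H Q f g cQ lipf mg); rewrite lerDl.
have [C1 C1_gt0 H1] : exists2 C : R, 0 < C & 1 < q < r -> estimate r C.
  have [/andP[q1 qr]|_] := boolP (1 < q < r); last by exists 1.
  have [A A0 hA] := exists_jump_const q_gt0 qr.
  pose C0 := tree_const p q (2 ^+ n.+1) A (weight_const q r - 1).
  have C0_ge0 : 0 <= C0.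
    apply: tree_const_ge0; rewrite ?exprn_ge0// subr_ge0.
    exact: ltW (weight_const_gt1 q_gt0 qr).
  apply: (@weaken _ r C0 _) => Q f g; apply: norm_estimate => //; first exact: ltW.
  move=> F K K0 FK F0 c0 G c0_gt0 mG iG Z hZ.
  exact: (cell_estimate_gt p_gt1 q_gt0 s_gt0 rho_gt0 (ltW qr) pq_rho pq_s K0 FK F0 mG iG
    qr A0 hA hZ).
have [C2 C2_gt0 H2] : exists2 C : R, 0 < C & q <= 1 -> estimate q C.
  have [q1|_] := boolP (q <= 1); last by exists 1.
  pose C0 := tree_const p q (2 ^+ n.+1) 1 1.
  have C0_ge0 : 0 <= C0 by apply: tree_const_ge0; rewrite ?exprn_ge0.
  apply: (@weaken _ q C0 _) => Q f g; apply: norm_estimate => //.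
  move=> F K K0 FK F0 c0 G c0_gt0 mG iG Z hZ.
  exact: (cell_estimate_le1 p_gt1 q_gt0 s_gt0 rho_gt0 (lexx q) pq_rho pq_s K0 FK F0 mG iG
    q1 erefl hZ).
exists (C1 + C2) => [|Q f cQ lipf]; first exact: addr_gt0.
split=> [qr g mg|q1 g mg].
  by apply: enlarge (H1 qr Q f g cQ lipf mg); rewrite lerDl ltW.
by apply: enlarge (H2 q1 Q f g cQ lipf mg); rewrite lerDr ltW.
Qed.
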